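(* Let $\mathbb{K}=\mathbb{R}$ or $\mathbb{C}$, let $k\ge 1$ and $n=2k+1$. Any complete solvable Lie algebra over $\mathbb{K}$ whose nilradical is isomorphic to the filiform Lie algebra $\mathrm{Q}_n$ is symplectic. Moreover, on its model $\mathfrak{g}=\mathfrak{h}\ltimes\mathrm{Q}_n$ with basis $e_0,e_1,\dots,e_{n+2}$ and nonzero brackets (up to skew-symmetry) $$[e_0,e_i]=e_{i+1}\ (1\le i\le n-2),\qquad [e_i,e_{n-i}]=(-1)^i e_n\ (1\le i\le k),$$ $$[e_{n+1},e_0]=e_0,\quad [e_{n+1},e_i]=(i-1)e_i\ (1\le i\le n-1),\quad [e_{n+1},e_n]=(n-2)e_n,$$ $$[e_{n+2},e_i]=e_i\ (1\le i\le n-1),\quad [e_{n+2},e_n]=2e_n,$$ an exact symplectic $2$-form is given by $\omega_n=\mathrm{d}e^0+\mathrm{d}e^n$.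
   Context: A finite-dimensional Lie algebra $\mathfrak{g}$ is complete if its center is trivial and all its derivations are inner. For $n=2k+1$, $\mathrm{Q}_n$ is the $(n+1)$-dimensional Lie algebra with basis $e_0,e_1,\dots,e_n$ and nonzero brackets (up to skew-symmetry) $[e_0,e_i]=e_{i+1}$ for $1\le i\le n-2$ and $[e_i,e_{n-i}]=(-1)^i e_n$ for $1\le i\le k$. Up to isomorphism, the complete solvable Lie algebra with nilradical $\mathrm{Q}_n$ is the $(n+3)$-dimensional algebra $\mathfrak{g}=\mathfrak{h}\ltimes\mathrm{Q}_n$ written in the claim, with $\mathrm{Q}_n=\mathrm{span}(e_0,\dots,e_n)$ and $\mathfrak{h}=\mathrm{span}(e_{n+1},e_{n+2})$ abelian. $(e^i)_{0\le i\le n+2}$ is the dual basis of $(e_i)$, and for $\alpha\in\mathfrak{g}^*$, $\mathrm{d}\alpha(x,y)=-\alpha([x,y])$. A symplectic form on $\mathfrak{g}$ is a non-degenerate skew-symmetric bilinear form $\omega$ with $\omega([x,y],z)+\omega([y,z],x)+\omega([z,x],y)=0$ for all $x,y,z\in\mathfrak{g}$; a Lie algebra is symplectic if it admits a symplectic form. *)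

(* Defs.v *)
From HB Require Import structures.
From mathcomp Require Import all_boot all_order all_algebra.
From mathcomp Require Import zify ring.
From mathcomp Require Import reals complex.

Set Implicit Arguments.
Unset Strict Implicit.
Unset Printing Implicit Defensive.

Import GRing.Theory.
Local Open Scope ring_scope.

HB.mixin Record Vector_isLieAlgebra (K : fieldType) L of Vector K L := {
  lie : L -> L -> L;
  lie_bilinear : bilinear_for *:%R *:%R lie;
  liexx : forall x, lie x x = 0;
  lie_jacobi : forall x y z,
    lie (lie x y) z + lie (lie y z) x + lie (lie z x) y = 0
}.

#[short(type="lieAlgType")]
HB.structure Definition LieAlgebra (K : fieldType) :=
  {L of Vector K L & Vector_isLieAlgebra K L}.

HB.instance Definition _ (K : fieldType) (L : lieAlgType K) :=
  bilinear_isBilinear.Build K L L L *:%R *:%R (@lie K L) (@lie_bilinear K L).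

Section LieAlgebraNotions.
Variables (K : fieldType) (L : lieAlgType K).
Implicit Types (U V N : {vspace L}) (x y z : L) (D : 'End(L)).

(* By bilinearity, this is the span of all [u, v] with u in U and v in V. *)
Definition lie_prod U V : {vspace L} :=
  <<[seq lie u v | u <- vbasis U, v <- vbasis V]>>%VS.

Definition lie_ideal U : Prop := forall x y, y \in U -> lie x y \in U.

Fixpoint lower_central U (m : nat) : {vspace L} :=
  if m is m'.+1 then lie_prod U (lower_central U m') else U.

Fixpoint derived_series U (m : nat) : {vspace L} :=
  if m is m'.+1 then lie_prod (derived_series U m') (derived_series U m')
  else U.

Definition lie_nilpotent U : Prop := exists m, lower_central U m = 0%VS.

Definition lie_solvable : Prop := exists m, derived_series fullv m = 0%VS.

Definition is_nilradical N : Prop :=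
  [/\ lie_ideal N, lie_nilpotent N &
      forall U, lie_ideal U -> lie_nilpotent U -> (U <= N)%VS].

Definition is_derivation D : Prop :=
  forall x y, D (lie x y) = lie (D x) y + lie x (D y).

Definition lie_complete : Prop :=
  (forall x, (forall y, lie x y = 0) -> x = 0) /\
  (forall D, is_derivation D -> exists x, forall y, D y = lie x y).

(* The subalgebra U of L is isomorphic to the Lie algebra M. *)
Definition sub_lie_isom (M : lieAlgType K) U : Prop :=
  exists f : 'Hom(M, L),
    [/\ lker f = 0%VS, limg f = U & forall x y : M, f (lie x y) = lie (f x) (f y)].

Definition lie_d (alpha : 'Hom(L, K^o)) (x y : L) : K := - alpha (lie x y).

Definition symplectic_form (w : L -> L -> K) : Prop :=
  [/\ bilinear_for *%R *%R w,
      forall x y, w x y = - w y x,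
      forall x, (forall y, w x y = 0) -> x = 0 &
      forall x y z, w (lie x y) z + w (lie y z) x + w (lie z x) y = 0].

Definition exact_form (w : L -> L -> K) : Prop :=
  exists alpha : 'Hom(L, K^o), forall x y, w x y = lie_d alpha x y.

Definition symplectic : Prop := exists w, symplectic_form w.

End LieAlgebraNotions.

Section Tables.
Variables (K : fieldType) (m : nat).

(* The i-th vector of the canonical basis, as a function of i : nat
   (0 when m <= i). *)
Definition e_ (i : nat) : 'rV[K]_m := \row_(j < m) (j == i :> nat)%:R.

(* The skew-symmetric bilinear product with [e_i, e_j] = t i j whenever
   t i j is listed as nonzero; t must not list both (i, j) and (j, i). *)
Definition table_lie (t : nat -> nat -> 'rV[K]_m) (x y : 'rV[K]_m) :
    'rV[K]_m :=
  \sum_(i < m) \sum_(j < m) (x 0 i * y 0 j) *: (t i j - t j i).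

Variable k : nat.
Let n := k.*2.+1.

Definition Q_table (i j : nat) : 'rV[K]_m :=
  if (i == 0%N) && (1 <= j <= n - 2)%N then e_ j.+1
  else if (1 <= i <= k)%N && (j == n - i)%N then (-1) ^+ i *: e_ n
  else 0.

Definition h_table (i j : nat) : 'rV[K]_m :=
  if i == n.+1 then
    if j == 0%N then e_ 0
    else if (1 <= j <= n - 1)%N then (j%:R - 1) *: e_ j
    else if j == n then (n%:R - 2) *: e_ n
    else 0
  else if i == n.+2 then
    if (1 <= j <= n - 1)%N then e_ j
    else if j == n then 2 *: e_ n
    else 0
  else 0.

Definition model_table (i j : nat) : 'rV[K]_m := Q_table i j + h_table i j.

End Tables.

Arguments e_ {K m} i.

Section TableTheory.
Variables (K : fieldType) (m : nat).
Implicit Types (t : nat -> nat -> 'rV[K]_m) (x y z : 'rV[K]_m).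

Lemma table_lie_bilinear t : bilinear_for *:%R *:%R (table_lie t).
Proof.
split=> z a x y; rewrite /table_lie /= scaler_sumr -big_split; apply: eq_bigr => i _;
  rewrite scaler_sumr -big_split; apply: eq_bigr => j _ /=;
  rewrite !mxE scalerA -scalerDl; congr (_ *: _); ring.
Qed.

HB.instance Definition _ t := bilinear_isBilinear.Build K
  'rV[K]_m 'rV[K]_m 'rV[K]_m *:%R *:%R (table_lie t) (table_lie_bilinear t).

Lemma table_lieC t x y : table_lie t x y = - table_lie t y x.
Proof.
rewrite /table_lie exchange_big -sumrN; apply: eq_bigr => i _.
rewrite -sumrN; apply: eq_bigr => j _.
by rewrite -scalerN opprB mulrC.
Qed.

Lemma table_liexx t x : table_lie t x x = 0.
Proof.
rewrite /table_lie; under eq_bigr do under eq_bigr do rewrite scalerBr.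
under eq_bigr do rewrite sumrB.
rewrite sumrB [X in _ - X]exchange_big /=; apply/eqP; rewrite subr_eq0.
by apply/eqP/eq_bigr => i _; apply: eq_bigr => j _; rewrite mulrC.
Qed.

Lemma e_delta (i : 'I_m) : e_ i = delta_mx 0 i :> 'rV[K]_m.
Proof. by apply/rowP => j; rewrite !mxE eqxx. Qed.

Lemma table_lieE t (i j : nat) : (i < m)%N -> (j < m)%N ->
  table_lie t (e_ i) (e_ j) = t i j - t j i.
Proof.
move=> li lj; pose i0 := Ordinal li; pose j0 := Ordinal lj.
have ei (a : nat) (la : (a < m)%N) (b : 'I_m) : b != Ordinal la ->
    (e_ a : 'rV[K]_m) 0 b = 0.
  by rewrite -val_eqE !mxE => /negbTE ->.
rewrite /table_lie (bigD1 i0) //= (bigD1 j0) //= !mxE !eqxx mulr1 scale1r.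
rewrite big1 => [|j' nj]; last by rewrite (ei _ lj) // mulr0 scale0r.
rewrite addr0 big1 ?addr0 // => i' ni; apply: big1 => j' _.
by rewrite (ei _ li) // mul0r scale0r.
Qed.

Let J t x y z := table_lie t (table_lie t x y) z
  + table_lie t (table_lie t y z) x + table_lie t (table_lie t z x) y.

Let JC t x y z : J t x y z = - J t y x z.
Proof.
rewrite /J (table_lieC _ x y) (table_lieC _ y z) (table_lieC _ z x) !linearNl /=.
by rewrite !opprD -!addrA; congr (_ + _); rewrite addrC.
Qed.

Let Jrot t x y z : J t x y z = J t y z x.
Proof. by rewrite /J [RHS]addrC addrA. Qed.

Let JP t a x x' y z : J t (a *: x + x') y z = a *: J t x y z + J t x' y z.
Proof.
rewrite /J; set B := table_lie t.
have Bl b u u' v : B (b *: u + u') v = b *: B u v + B u' v by exact: linearPl.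
have Br b u u' v : B v (b *: u + u') = b *: B v u + B v u' by exact: linearPr.
by rewrite !(Bl, Br) !scalerDr [X in X + _]addrACA [LHS]addrACA.
Qed.

Lemma table_jacobi t :
    (forall i j l : nat, (i < j < l)%N -> (l < m)%N ->
       J t (e_ i) (e_ j) (e_ l) = 0) ->
  forall x y z, J t x y z = 0.
Proof.
move=> H.
have Hxx x z : J t x x z = 0.
  by rewrite /J table_liexx linear0l add0r (table_lieC t z x) linearNl subrr.
have H1 (i j l : 'I_m) : J t (e_ i) (e_ j) (e_ l) = 0.
  wlog lij : i j l / (i < j)%N.
    move=> W; case: (ltngtP i j) => [/W//|/W h|/val_inj ->]; last exact: Hxx.
    by rewrite JC h oppr0.
  case: (ltngtP j l) => [ljl|llj|/val_inj ->].
  - by apply: H => //; rewrite lij.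
  - case: (ltngtP i l) => [lil|lli|/val_inj ->].
    + by rewrite Jrot Jrot JC H ?oppr0 // lil.
    + by rewrite Jrot Jrot; apply: H => //; rewrite lli.
    + by rewrite Jrot Jrot Hxx.
  - by rewrite Jrot Hxx.
have ext y z : (forall i : 'I_m, J t (e_ i) y z = 0) -> forall x, J t x y z = 0.
  move=> Hi x; rewrite (row_sum_delta x).
  elim/big_rec: _ => [|i v _ IH].
    by rewrite /J !(linear0l, linear0r) !addr0.
  by rewrite JP IH -e_delta Hi scaler0 addr0.
move=> x y z; apply: (ext _ _) => i; rewrite Jrot; apply: (ext _ _) => j.
by rewrite Jrot; apply: (ext _ _) => l; apply: H1.
Qed.

Variable k : nat.
Local Notation n := k.*2.+1.
Local Notation E := (@e_ K m).
Local Notation "[ i , j ]" := (table_lie (model_table K m k) (E i) (E j)).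

Hypothesis nm : (n < m)%N.

#[local] Ltac ifs := repeat
  match goal with |- context [if ?b then _ else _] =>
    let H := fresh in case H : b; try (exfalso; lia)
  end.
#[local] Ltac table :=
  rewrite table_lieE; [|lia..];
  rewrite /model_table /Q_table /h_table; ifs;
  rewrite ?(scale0r, addr0, add0r, subr0, oppr0).

Let b0m i : (0 < i < n.-1)%N -> [0%N, i] = E i.+1.
Proof. by move=> hi; table. Qed.

Let b0n i : (n.-1 <= i <= n)%N -> [0%N, i] = 0.
Proof. by move=> hi; table. Qed.

Let bmm i j : (0 < i <= n)%N -> (0 < j <= n)%N ->
  [i, j] = (if (i + j == n)%N then (-1) ^+ i else 0) *: E n.
Proof.
move=> li lj; table => //.
rewrite -scaleNr; congr (_ *: _).
rewrite -signr_odd -[RHS]signr_odd.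
have -> : odd i = ~~ odd j by lia.
by case: odd; rewrite ?expr1 ?expr0 ?opprK.
Qed.

Let bh0 : (n.+1 < m)%N -> [n.+1, 0%N] = E 0.
Proof. by move=> hm; table. Qed.

Let bhm i : (n.+1 < m)%N -> (0 < i < n)%N -> [n.+1, i] = (i%:R - 1) *: E i.
Proof. by move=> hm hi; table. Qed.

Let bhn : (n.+1 < m)%N -> [n.+1, n] = (n%:R - 2) *: E n.
Proof. by move=> hm; table. Qed.

Let bk0 : (n.+2 < m)%N -> [n.+2, 0%N] = 0.
Proof. by move=> hm; table. Qed.

Let bkm i : (n.+2 < m)%N -> (0 < i < n)%N -> [n.+2, i] = E i.
Proof. by move=> hm hi; table. Qed.

Let bkn : (n.+2 < m)%N -> [n.+2, n] = 2 *: E n.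
Proof. by move=> hm; table. Qed.

Let bhk : (n.+2 < m)%N -> [n.+2, n.+1] = 0.
Proof. by move=> hm; table. Qed.

Let wa i : K := if i == 0%N then 1 else if (i < n)%N then i%:R - 1 else n%:R - 2.
Let wb i : K := if i == 0%N then 0 else if (i < n)%N then 1 else 2.

Let bhE i : (n.+1 < m)%N -> (i <= n)%N -> [n.+1, i] = wa i *: E i.
Proof.
move=> hm hi; rewrite /wa; case: eqP => [->|/eqP i0]; first by rewrite bh0 // scale1r.
case: ltnP => h; first by rewrite bhm //; lia.
by have -> : i = n by [lia]; rewrite bhn.
Qed.

Let bkE i : (n.+2 < m)%N -> (i <= n)%N -> [n.+2, i] = wb i *: E i.
Proof.
move=> hm hi; rewrite /wb; case: eqP => [->|/eqP i0]; first by rewrite bk0 // scale0r.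
case: ltnP => h; first by rewrite bkm // ?scale1r //; lia.
by have -> : i = n by [lia]; rewrite bkn.
Qed.

Local Notation B := (table_lie (model_table K m k)).

Let BZl c x y : B (c *: x) y = c *: B x y. Proof. exact: linearZl_LR. Qed.
Let BZr c x y : B x (c *: y) = c *: B x y. Proof. exact: linearZr_LR. Qed.
Let BNl x y : B (- x) y = - B x y. Proof. exact: linearNl. Qed.
Let B0l x : B 0 x = 0. Proof. exact: linear0l. Qed.
Let B0r x : B x 0 = 0. Proof. exact: linear0r. Qed.

Let weight (h : nat) (w : nat -> K) :
    (forall i, (i <= n)%N -> [h, i] = w i *: E i) ->
    (forall j, (0 < j < n.-1)%N -> w j.+1 = w 0%N + w j) ->
    (forall i j, (0 < i)%N -> (0 < j)%N -> (i + j = n)%N -> w n = w i + w j) ->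
  forall i j, (i < j <= n)%N -> J (model_table K m k) (E i) (E j) (E h) = 0.
Proof.
move=> hw w0 w1 i j hij; rewrite /J.
rewrite (table_lieC _ (B _ _) (E h)) (table_lieC _ (E j) (E h)).
rewrite !hw ?BNl ?BZl ?(table_lieC _ (E j) (E i)) ?scalerN ?opprK; [|lia..].
rewrite -addrA -scalerDl; apply/eqP; rewrite addrC subr_eq0; apply/eqP.
case: i hij => [|i] hij.
  case: (ltnP j n.-1) => hj.
    by rewrite b0m ?hw ?w0 1?addrC //; lia.
  by rewrite b0n ?B0r ?scaler0 //; lia.
rewrite bmm; [|lia..]; case: eqP => e; last by rewrite !scale0r scaler0 B0r.
by rewrite BZr hw // (w1 i.+1 j) //; [rewrite !scalerA mulrC addrC|lia].
Qed.

Hypothesis mn : (m <= n.+3)%N.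

Lemma model_jacobi x y z :
  table_lie (model_table K m k) (table_lie (model_table K m k) x y) z
  + table_lie (model_table K m k) (table_lie (model_table K m k) y z) x
  + table_lie (model_table K m k) (table_lie (model_table K m k) z x) y = 0.
Proof.
move: x y z; apply: table_jacobi => i j l ijl lm.
have nat1 (p q : nat) : (p + q = n)%N -> n%:R = p%:R + q%:R :> K.
  by move=> <-; rewrite natrD.
have wa0 (p : nat) : (0 < p < n.-1)%N -> wa p.+1 = wa 0 + wa p.
  move=> hp; rewrite /wa /=.
  have -> : (p == 0%N) = false by lia.
  have -> : (p < n)%N by lia.
  have -> : (p.+1 < n)%N by lia.
  by rewrite -(natr1 p); ring.
have wan (p q : nat) : (0 < p)%N -> (0 < q)%N -> (p + q = n)%N -> wa n = wa p + wa q.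
  move=> p0 q0 pq; rewrite /wa ltnn /=.
  have -> : (p == 0%N) = false by lia.
  have -> : (q == 0%N) = false by lia.
  have -> : (p < n)%N by lia.
  have -> : (q < n)%N by lia.
  by rewrite (nat1 p q) //; ring.
have wb0 (p : nat) : (0 < p < n.-1)%N -> wb p.+1 = wb 0 + wb p.
  move=> hp; rewrite /wb /=.
  have -> : (p == 0%N) = false by lia.
  have -> : (p < n)%N by lia.
  have -> : (p.+1 < n)%N by lia.
  by rewrite add0r.
have wbn (p q : nat) : (0 < p)%N -> (0 < q)%N -> (p + q = n)%N -> wb n = wb p + wb q.
  move=> p0 q0 pq; rewrite /wb ltnn /=.
  have -> : (p == 0%N) = false by lia.
  have -> : (q == 0%N) = false by lia.
  have -> : (p < n)%N by lia.
  have -> : (q < n)%N by lia.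
  by [].
case: (leqP l n) => ln.
  rewrite /J; case: i ijl => [|i] ijl; last first.
    rewrite !bmm ?(BZl, bmm); try lia.
    have nF p : (0 < p)%N -> ((n + p)%N == n) = false by lia.
    rewrite !nF; try lia.
    by rewrite !scale0r !scaler0 !addr0.
  rewrite (table_lieC _ (E l) (E 0)) BNl.
  rewrite (bmm (i := j)); [|lia..].
  rewrite BZl (table_lieC _ (E n) (E 0)) (@b0n n) ?oppr0 ?scaler0 ?addr0; [|lia].
  case: (ltnP l n.-1) => ll.
    rewrite !b0m ?bmm; try lia.
    have -> : (l.+1 + j = j.+1 + l)%N by lia.
    case: eqP => e; last by rewrite !scale0r subrr.
    rewrite -signr_odd -[in X in _ - X]signr_odd.
    by have -> : odd l.+1 = odd j.+1 by [lia]; rewrite subrr.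
  rewrite (@b0n l) ?B0l ?oppr0 ?addr0; [|lia].
  case: (ltnP j n.-1) => jl; last by rewrite b0n ?B0l //; lia.
  by rewrite b0m ?bmm ?ifF ?scale0r //; lia.
case: (leqP j n) => jn.
  have [e|e] : l = n.+1 \/ l = n.+2 by lia.
    by subst l; apply: (weight _ wa0 wan); [move=> *; apply: bhE; lia|lia].
  by subst l; apply: (weight _ wb0 wbn); [move=> *; apply: bkE; lia|lia].
have -> : j = n.+1 by lia.
have -> : l = n.+2 by lia.
rewrite /J (table_lieC _ (E i) (E n.+1)) (table_lieC _ (E n.+1) (E n.+2)).
rewrite bhk ?oppr0 ?B0l ?addr0; [|lia].
rewrite bhE ?bkE ?BNl ?BZl; [|lia..].
rewrite (table_lieC _ (E i) (E n.+1)) (table_lieC _ (E i) (E n.+2)).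
rewrite bhE ?bkE; [|lia..].
by rewrite !scalerN opprK !scalerA mulrC subrr.
Qed.
End TableTheory.

Lemma Q_jacobi (K : fieldType) (k : nat) (x y z : 'rV[K]_(k.*2.+2)) :
  table_lie (Q_table K _ k) (table_lie (Q_table K _ k) x y) z
  + table_lie (Q_table K _ k) (table_lie (Q_table K _ k) y z) x
  + table_lie (Q_table K _ k) (table_lie (Q_table K _ k) z x) y = 0.
Proof.
have QE u v : table_lie (Q_table K _ k) u v
            = table_lie (model_table K k.*2.+2 k) u v.
  have h0 (i : 'I_k.*2.+2) j : h_table K k.*2.+2 k i j = 0.
    by rewrite /h_table !ifF //; have := ltn_ord i; lia.
  apply: eq_bigr => i _; apply: eq_bigr => j _.
  by rewrite /model_table !h0 !addr0.
by rewrite !QE; apply: model_jacobi; lia.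
Qed.

(* The Lie algebra Q_n for n = 2k+1. *)
Definition Q_alg (K : fieldType) (k : nat) : Type := 'rV[K]_(k.*2.+2).

HB.instance Definition _ (K : fieldType) (k : nat) := Vector.on (Q_alg K k).
HB.instance Definition _ (K : fieldType) (k : nat) :=
  Vector_isLieAlgebra.Build K (Q_alg K k)
    (table_lie_bilinear (Q_table K k.*2.+2 k))
    (table_liexx (Q_table K k.*2.+2 k))
    (@Q_jacobi K k).

(* The Lie algebra g = h |x Q_n for n = 2k+1. *)
Definition model (K : fieldType) (k : nat) : Type := 'rV[K]_(k.*2.+4).

HB.instance Definition _ (K : fieldType) (k : nat) := Vector.on (model K k).
HB.instance Definition _ (K : fieldType) (k : nat) :=
  Vector_isLieAlgebra.Build K (model K k)
    (table_lie_bilinear (model_table K k.*2.+4 k))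
    (table_liexx (model_table K k.*2.+4 k))
    (@model_jacobi K k.*2.+4 k (leq_addl 2 k.*2.+2) (leqnn k.*2.+4)).

Section DualBasis.
Variables (K : fieldType) (k : nat).

Definition model_coord (i : nat) (x : model K k) : K^o := x 0 (inord i).

Lemma model_coord_linear i : linear (model_coord i).
Proof. by move=> a x y; rewrite /model_coord !mxE. Qed.

HB.instance Definition _ i := GRing.isLinear.Build K (model K k) K^o *:%R
  (model_coord i) (model_coord_linear i).

Definition dual_e (i : nat) : 'Hom(model K k, K^o) := linfun (model_coord i).

Lemma dual_eE (i j : nat) : (i < k.*2.+4)%N ->
  dual_e i (e_ j : model K k) = (i == j)%:R.
Proof. by move=> hi; rewrite lfunE /= /model_coord mxE inordK. Qed.

Definition omega (x y : model K k) : K :=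
  lie_d (dual_e 0) x y + lie_d (dual_e k.*2.+1) x y.

End DualBasis.

(* Main.v *)
Require Import Defs.
From HB Require Import structures.
From mathcomp Require Import all_boot all_order all_algebra.
From mathcomp Require Import zify ring.
From mathcomp Require Import boolp reals complex.

(* The nilradical is a copy of Q_n, and every derivation of Q_n is triangular
   in the basis e_1, e_0, e_2, ..., e_n, with diagonal determined by its entries
   a at e_0 and b at e_1.  Through the adjoint action, a and b become linear
   forms on g; they vanish on [g, g], and their common kernel is a nilpotent
   ideal, hence the nilradical.

   Completeness forces (a, b) : g -> K^2 to be onto.  Otherwise g is Q_n, which
   has a center, or Q_n extended by one element x.  In the latter case, every
   derivation of Q_n commuting with ad x modulo inner derivations extends to g,
   so it must be inner modulo ad x; depending on the resonances between a(x)
   and b(x), an explicit derivation contradicts this.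

   Once (a, b) is onto, put alpha = s e^0 + e^n on the nilradical.  The radical
   of alpha([., .]) on Q_n is spanned by e_0 and e_n, and g / Q_n is paired with
   it by a 2x2 matrix whose determinant is a nonconstant affine function of s;
   so no normal form of g is needed. *)

Set Implicit Arguments.
Unset Strict Implicit.
Unset Printing Implicit Defensive.

Import GRing.Theory.
Local Open Scope ring_scope.

(** * Exact 2-forms on a Lie algebra *)

Section ExactForms.
Variables (K : fieldType) (L : lieAlgType K).

Lemma lieC (x y : L) : lie x y = - lie y x.
Proof.
apply/eqP; rewrite -addr_eq0; apply/eqP.
have := liexx (x + y).
by rewrite linearDl /= !linearDr /= !liexx addr0 add0r.
Qed.

(** The Jacobi identity makes [lie_d alpha] closed, so only nondegeneracy has to be supplied. *)
Lemma exact_symplectic (alpha : 'Hom(L, K^o)) (w : L -> L -> K) :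
  (forall x y, w x y = lie_d alpha x y) ->
  (forall x, (forall y, alpha (lie x y) = 0) -> x = 0) ->
  symplectic_form w.
Proof.
move=> wE nd; split.
- split=> z a x y /=; rewrite !wE /lie_d.
    by rewrite linearPl linearP opprD mulrN.
  by rewrite linearPr linearP opprD mulrN.
- by move=> x y; rewrite !wE /lie_d (lieC y) linearN !opprK.
- move=> x hx; apply: nd => y.
  by apply/eqP; rewrite -oppr_eq0; move: (hx y); rewrite wE => /eqP.
- by move=> x y z; rewrite !wE /lie_d -!opprD; have /= := congr1 alpha (lie_jacobi x y z);
    rewrite !linearD linear0 => ->; rewrite oppr0.
Qed.

End ExactForms.

Lemma table_lie_er (K : fieldType) (m : nat) (t : nat -> nat -> 'rV[K]_m) x (j : 'I_m) :
  table_lie t x (e_ j) = \sum_(i < m) x 0 i *: (t i j - t j i).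
Proof.
apply: eq_bigr => i _; rewrite (bigD1 j) //= big1 => [|l nl].
  by rewrite mxE eqxx mulr1 addr0.
by rewrite mxE -val_eqE in nl *; rewrite (negbTE nl) mulr0 scale0r.
Qed.

Ltac case_ifs := repeat
  match goal with |- context [if ?b then _ else _] =>
    let H := fresh in case H : b; try (exfalso; lia)
  end.

Ltac eval_bool := repeat match goal with |- context [nat_of_bool ?b] =>
    lazymatch b with true => fail | false => fail | _ => idtac end;
    first [have -> : b = false by lia | have -> : b = true by lia] end.
Ltac simp0 := rewrite /= ?mulr0 ?mulr1 ?subr0 ?add0r ?addr0 ?sub0r ?oppr0 ?subrr //.

(** * The exact form on the model *)

Section Model.
Variables (K : fieldType) (k : nat).
Local Notation n := k.*2.+1.
Hypothesis two_neq0 : 2 != 0 :> K.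

Definition model_form : 'Hom(model K k, K^o) := dual_e K k 0 + dual_e K k n.

Lemma omegaE x y : omega x y = lie_d model_form x y.
Proof. by rewrite /omega /lie_d add_lfunE opprD. Qed.

Lemma model_exact : exact_form (@omega K k).
Proof. by exists model_form; apply: omegaE. Qed.

(** Only the listed half of the bracket table: the Gram matrix of the form is this matrix minus its
    transpose. *)
Definition model_gram (i j : nat) : K :=
  if (1 <= i <= k)%N && (j == n - i)%N then (-1) ^+ i
  else if i == n.+1 then if j == 0%N then 1 else if j == n then n%:R - 2 else 0
  else if i == n.+2 then if j == n then 2 else 0
  else 0.

Lemma model_form_table i j : (i < n.+3)%N -> (j < n.+3)%N ->
  model_form (model_table K n.+3 k i j : model K k) = model_gram i j.
Proof.
move=> hi hj; rewrite /model_form add_lfunE !lfunE /= /model_coord.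
rewrite /model_table /Q_table /h_table /model_gram.
by case_ifs; rewrite !mxE ?inordK; try lia; eval_bool; simp0.
Qed.

Lemma model_form_lie (x : model K k) (j : 'I_n.+3) :
  model_form (lie x (e_ j : model K k)) =
  \sum_(i < n.+3) x 0 i * (model_gram i j - model_gram j i).
Proof.
rewrite [lie _ _]table_lie_er linear_sum; apply: eq_bigr => i _ /=.
by rewrite linearZ linearB /= !model_form_table.
Qed.

(** The columns n+2, n+1, 0, n and then n-i of the Gram matrix are used in this order. Once the
    coordinates already known to vanish are dropped, each has a single nonzero entry, in row n, 0,
    n+1, n+2 and i respectively. *)
Lemma model_form_nondegenerate (x : model K k) :
  (forall y, model_form (lie x y) = 0) -> x = 0.
Proof.
move=> hx.
have single (i j : 'I_n.+3) :
    (forall l : 'I_n.+3, l != i -> x 0 l * (model_gram l j - model_gram j l) = 0) ->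
    x 0 i * (model_gram i j - model_gram j i) = 0.
  move=> h; have := hx (e_ j); rewrite model_form_lie (bigD1 i) //= big1 ?addr0 //.
(* [o] is [inord] with its definition hidden, so that it is known only through [oE]. *)
have [o oE] : exists o : nat -> 'I_n.+3, forall i : nat, (i < n.+3)%N -> o i = i :> nat.
  by exists (fun i => inord i) => i hi; rewrite inordK.
have xl (l : 'I_n.+3) (i : nat) : x 0 (o i) = 0 -> l = i :> nat -> x 0 l = 0.
  move=> h e; suff -> : l = o i by []; apply: ord_inj; rewrite oE // -e; exact: ltn_ord.
have xn : x 0 (o n) = 0.
  have := single (o n) (o n.+2); rewrite !oE; try lia.
  rewrite {3 4}/model_gram; case_ifs => //; rewrite sub0r mulrN => /(_ _)/eqP; rewrite oppr_eq0 mulf_eq0.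
  rewrite (negbTE two_neq0) orbF => h; apply/eqP/h => l.
  rewrite -val_eqE /= oE; [|lia] => nl; rewrite /model_gram; have ll := ltn_ord l; case_ifs.
all: rewrite ?subrr ?mulr0 //.
have x0 : x 0 (o 0%N) = 0.
  have := single (o 0%N) (o n.+1); rewrite !oE; try lia.
  rewrite {3 4}/model_gram; case_ifs => //; rewrite sub0r mulrN1 => /(_ _)/eqP; rewrite oppr_eq0.
  move=> h; apply/eqP/h => l.
  rewrite -val_eqE /= oE; [|lia] => nl; have [/(xl _ _ xn) ->|nn] := eqVneq (l : nat) n.
    by rewrite mul0r.
  rewrite /model_gram; have ll := ltn_ord l; case_ifs.
all: rewrite ?subrr ?mulr0 //.
have xn1 : x 0 (o n.+1) = 0.
  have := single (o n.+1) (o 0%N); rewrite !oE; try lia.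
  rewrite {3 4}/model_gram; case_ifs => //; rewrite subr0 mulr1; apply => l.
  rewrite -val_eqE /= oE; [|lia] => nl.
  rewrite /model_gram; have ll := ltn_ord l; case_ifs.
  all: rewrite ?subrr ?mulr0 //.
have xn2 : x 0 (o n.+2) = 0.
  have := single (o n.+2) (o n); rewrite !oE; try lia.
  rewrite {3 4}/model_gram; case_ifs => //; rewrite subr0 => /(_ _)/eqP; rewrite mulf_eq0.
  rewrite (negbTE two_neq0) orbF => h; apply/eqP/h => l.
  rewrite -val_eqE /= oE; [|lia] => nl; have [/(xl _ _ xn1) ->|nn] := eqVneq (l : nat) n.+1.
    by rewrite mul0r.
  rewrite /model_gram; have ll := ltn_ord l; case_ifs.
  all: rewrite ?subrr ?mulr0 //.
apply/rowP => i; rewrite [RHS]mxE.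
have [i0|ni0] := eqVneq (i : nat) 0%N; first exact: xl x0 i0.
have [/(xl _ _ xn)->//|nin] := eqVneq (i : nat) n.
have [/(xl _ _ xn1)->//|nin1] := eqVneq (i : nat) n.+1.
have [/(xl _ _ xn2)->//|nin2] := eqVneq (i : nat) n.+2.
have il := ltn_ord i.
have := single i (o (n - i)%N); rewrite !oE; try lia.
have sgn (p : nat) : (-1) ^+ p != 0 :> K by rewrite signr_eq0.
suff : model_gram i (n - i)%N - model_gram (n - i)%N i != 0.
  move=> gi h; apply/eqP; move: (h)=> /(_ _)/eqP; rewrite mulf_eq0 (negbTE gi) orbF; apply=> l.
  rewrite -val_eqE /= => nl; rewrite /model_gram; have ll := ltn_ord l; case_ifs.
  all: rewrite ?subrr ?mulr0 //.
rewrite /model_gram; case_ifs; by rewrite ?sub0r ?subr0 ?oppr_eq0.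
Qed.
End Model.

(** * The bracket of Q_n in coordinates *)

Section QBracket.
Variables (K : fieldType) (k : nat).
Local Notation n := k.*2.+1.
Local Notation Q := (Q_alg K k).

Definition crd (i : nat) (x : Q) : K^o := x 0 (inord i).

Lemma crd_linear i : linear (crd i).
Proof. by move=> a x y; rewrite /crd !mxE. Qed.

HB.instance Definition _ i := GRing.isLinear.Build K Q K^o *:%R
  (crd i) (crd_linear i).

Lemma crdZ i a (x : Q) : crd i (a *: x) = a * crd i x.
Proof. exact: linearZ. Qed.

Lemma crd_e i j : (i <= n)%N -> crd i (e_ j : Q) = (i == j)%:R.
Proof. by move=> hi; rewrite /crd mxE inordK. Qed.

Lemma crd_inj (x y : Q) : (forall i, (i <= n)%N -> crd i x = crd i y) -> x = y.
Proof.
by move=> h; apply/rowP => i; have := h i (ltn_ord i); rewrite /crd inord_val.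
Qed.

Lemma crd_ord (x : Q) (i : 'I_n.+1) : x 0 i = crd i x.
Proof. by rewrite /crd inord_val. Qed.

Lemma crd_lie_table l (x y : Q) : crd l (lie x y) = \sum_(i < n.+1) \sum_(j < n.+1)
  crd i x * crd j y * (crd l (Q_table K n.+1 k i j : Q) - crd l (Q_table K n.+1 k j i : Q)).
Proof.
rewrite [lie x y]/(table_lie _ x y) /table_lie linear_sum; apply: eq_bigr => i _.
rewrite linear_sum; apply: eq_bigr => j _.
by rewrite linearZ linearB /= !crd_ord.
Qed.

Lemma crd_lie_lo l (x y : Q) : (l <= 1)%N -> crd l (lie x y) = 0.
Proof.
move=> hl; rewrite crd_lie_table big1 // => i _; rewrite big1 // => j _.
apply/eqP; rewrite mulf_eq0; apply/orP; right; apply/eqP; rewrite /Q_table.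
case_ifs; rewrite ?crdZ ?linear0 ?crd_e; try lia; eval_bool; simp0.
Qed.

Lemma sum_pair (a b : nat) (x y : Q) : (a <= n)%N -> (b <= n)%N ->
  \sum_(i < n.+1) \sum_(j < n.+1) crd i x * crd j y * ((i == a :> nat) && (j == b :> nat))%:R
  = crd a x * crd b y.
Proof.
move=> ha hb; have ia : (a < n.+1)%N by []; have ib : (b < n.+1)%N by [].
rewrite (bigD1 (Ordinal ia)) //= (bigD1 (Ordinal ib)) //= !eqxx mulr1.
rewrite big1 ?addr0 => [|j]; last by rewrite -val_eqE /= => /negbTE ->; rewrite mulr0.
rewrite big1 ?addr0 // => i; rewrite -val_eqE /= => /negbTE ->.
by rewrite big1 // => j _; rewrite mulr0.
Qed.

Lemma crd_lie_mid l (x y : Q) : (1 < l < n)%N ->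
  crd l (lie x y) = crd 0 x * crd l.-1 y - crd l.-1 x * crd 0 y.
Proof.
move=> hl; rewrite crd_lie_table -!sum_pair; [|lia..].
rewrite -sumrB; apply: eq_bigr => i _; rewrite -sumrB; apply: eq_bigr => j _.
rewrite -mulrBr; congr (_ * _); rewrite /Q_table.
have := ltn_ord i; have := ltn_ord j => hj hi.
case_ifs; rewrite ?crdZ ?linear0 ?crd_e; try lia; eval_bool; simp0.
all: rewrite ?mulNrn; do ?congr (- _); congr (_ *+ nat_of_bool _); lia.
Qed.

(** The table stops at i = k. Skew-symmetry supplies the larger indices with the same sign formula,
    because n is odd and so i and n - i have opposite parities. *)
Lemma crd_lie_hi (x y : Q) :
  crd n (lie x y) = \sum_(1 <= i < n) (-1) ^+ i * crd i x * crd (n - i) y.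
Proof.
(* The summand is extended by zero to the indices 0 and n, to be compared termwise with the sum over
   ordinals. *)
pose F (i : nat) := if (0 < i < n)%N then (-1) ^+ i * crd i x * crd (n - i) y else 0.
transitivity (\sum_(0 <= i < n.+1) F i); last first.
  rewrite big_nat_recr // big_ltn //=.
  have -> : F 0%N = 0 by [].
  have -> : F n = 0 by rewrite /F ltnn andbF.
  rewrite add0r addr0.
  by apply: eq_big_nat => i hi; rewrite /F hi.
rewrite crd_lie_table big_mkord; apply: eq_bigr => i _.
have hi := ltn_ord i; rewrite /F; case: ifP => h; last first.
  rewrite big1 // => j _; have hj := ltn_ord j.
  apply/eqP; rewrite mulf_eq0; apply/orP; right; apply/eqP; rewrite /Q_table.
  case_ifs; rewrite ?crdZ ?linear0 ?crd_e; try lia; eval_bool; simp0.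
have hj : (n - i < n.+1)%N by lia.
rewrite (bigD1 (Ordinal hj)) //= big1 => [|j]; last first.
  rewrite -val_eqE /= => nj; have lj := ltn_ord j.
  apply/eqP; rewrite mulf_eq0; apply/orP; right; apply/eqP; rewrite /Q_table.
  case_ifs; rewrite ?crdZ ?linear0 ?crd_e; try lia; eval_bool; simp0.
rewrite addr0 mulrC mulrA; congr (_ * _ * _); rewrite /Q_table.
case_ifs; rewrite ?crdZ ?linear0 ?crd_e; try lia; eval_bool; simp0.
rewrite -signr_odd -[RHS]signr_odd.
have -> : odd i = ~~ odd (n - i) by lia.
by case: odd; rewrite ?expr1 ?expr0 ?opprK.
Qed.

Lemma crd_lie_hie (x : Q) j : (0 < j < n)%N ->
  crd n (lie x (e_ j : Q)) = - (-1) ^+ j * crd (n - j) x.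
Proof.
move=> hj; rewrite crd_lie_hi (bigD1_seq (n - j)%N) /= ?iota_uniq ?mem_index_iota; [|lia..].
rewrite big_nat_cond big1 => [|i]; last first.
  by move=> hi; rewrite crd_e; [have -> : (n - i == j)%N = false by lia|lia]; rewrite mulr0.
rewrite addr0 crd_e; [|lia]; have -> : (n - (n - j) == j)%N by lia.
rewrite mulr1 -signr_odd -[in RHS]signr_odd; congr (_ * _).
have -> : odd (n - j) = ~~ odd j by lia.
by case: odd; rewrite ?expr1 ?expr0 ?opprK.
Qed.

End QBracket.

(** * Derivations of an arbitrary Lie algebra *)

Section Derivations.
Variables (K : fieldType) (L : lieAlgType K).
Implicit Types (x y : L) (D : 'End(L)).

HB.instance Definition _ x := GRing.isLinear.Build K L L *:%R (lie x)
  (lie_bilinear.2 x).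

Definition ad x : 'End(L) := linfun (lie x).

Lemma adE x y : ad x y = lie x y.
Proof. by rewrite /ad lfunE. Qed.

Lemma ad_derivation x : is_derivation (ad x).
Proof.
move=> y z; rewrite !adE (lieC y (lie x z)) (lieC x (lie y z)).
rewrite (lieC x z) linearNl /= opprK.
by apply/esym/eqP; rewrite -subr_eq0 opprK addrAC lie_jacobi.
Qed.

Lemma derivationD D D' : is_derivation D -> is_derivation D' -> is_derivation (D + D').
Proof.
move=> hD hD' x y; rewrite !add_lfunE hD hD' linearDl linearDr /=.
by rewrite addrACA.
Qed.

Lemma derivationZ c D : is_derivation D -> is_derivation (c *: D).
Proof. by move=> hD x y; rewrite !scale_lfunE hD scalerDr linearZl_LR linearZr_LR. Qed.

(** In D1 (D2 [x, y]) the mixed terms are symmetric in D1 and D2, so they cancel in the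
    commutator. *)
Lemma derivation_comm D D' :
  is_derivation D -> is_derivation D' -> is_derivation ((D \o D') - (D' \o D))%VF.
Proof.
have two (D1 D2 : 'End(L)) x y : is_derivation D1 -> is_derivation D2 ->
    D1 (D2 (lie x y)) = lie (D1 (D2 x)) y + lie x (D1 (D2 y))
      + (lie (D2 x) (D1 y) + lie (D1 x) (D2 y)).
  move=> h1 h2; rewrite h2 linearD /= !h1; by rewrite [LHS](AC (2*2) ((1*4)*(2*3))).
move=> hD hD' x y; rewrite !(add_lfunE, opp_lfunE, comp_lfunE) !two //.
rewrite linearDl linearDr linearNl linearNr /= [X in _ - (_ + X)]addrC.
by rewrite opprD addrACA subrr addr0 opprD addrACA.
Qed.

End Derivations.

(** * Generators of Q_n *)

Section QDerivations.
Variables (K : fieldType) (k : nat).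
Local Notation n := k.*2.+1.
Local Notation Q := (Q_alg K k).
Local Notation E i := (e_ i : Q).
Hypothesis k_gt0 : (0 < k)%N.

Lemma crd_lie_e0 j (x : Q) : (j <= n)%N ->
  crd j (lie x (E 0)) = if (1 < j < n)%N then - crd j.-1 x else 0.
Proof.
move=> hj; case: ifP => h.
  rewrite crd_lie_mid // !crd_e; [|lia..]; eval_bool; rewrite mulr0 mulr1 sub0r //.
have [l1|l1] := leqP j 1; first by rewrite crd_lie_lo.
have -> : j = n by lia.
rewrite crd_lie_hi big_nat_cond big1 // => i hi; rewrite crd_e; [|lia].
by eval_bool; rewrite mulr0.
Qed.

Lemma crd_lie_e1 j (x : Q) : (j <= n)%N ->
  crd j (lie x (E 1)) = if j == 2%N then crd 0 x else if j == n then crd n.-1 x else 0.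
Proof.
move=> hj; have [l1|l1] := leqP j 1; first by rewrite crd_lie_lo // !ifF //; lia.
have [->|jn] := eqVneq j n.
  by rewrite crd_lie_hie ?ifF; [rewrite expr1 opprK mul1r subn1|lia..].
rewrite crd_lie_mid ?crd_e; [|lia..].
by rewrite [(_.-1 == _)%N](_ : _ = (j == 2%N)); [case: eqP => e; simp0|lia].
Qed.

Lemma lie_e0_e i : (0 < i < n.-1)%N -> lie (E 0) (E i) = E i.+1.
Proof.
move=> hi; rewrite [LHS]table_lieE; [|lia..].
by rewrite /Q_table; case_ifs; rewrite ?subr0 ?sub0r.
Qed.

Lemma lie_e0_last : lie (E 0) (E n.-1) = 0.
Proof.
rewrite [LHS]table_lieE; [|lia..].
by rewrite /Q_table; case_ifs; rewrite ?subr0 ?sub0r.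
Qed.

Lemma lie_e1_last : lie (E 1) (E n.-1) = - E n.
Proof.
rewrite [LHS]table_lieE; [|lia..].
by rewrite /Q_table; case_ifs; rewrite ?subr0 ?sub0r expr1 scaleN1r.
Qed.

Lemma lie_e1_e2 : (1 < k)%N -> lie (E 1) (E 2) = 0.
Proof.
move=> hk; rewrite [LHS]table_lieE; [|lia..].
by rewrite /Q_table; case_ifs; rewrite ?subr0 ?sub0r.
Qed.

Lemma Q_sum (x : Q) : x = \sum_(i < n.+1) crd i x *: E i.
Proof.
rewrite [LHS](row_sum_delta (x : 'rV_n.+1)); apply: eq_bigr => i _.
by rewrite e_delta crd_ord.
Qed.

(** e_0 and e_1 generate Q_n: brackets with e_0 produce e_2, ..., e_{n-1}, and e_n =
    -[e_1, e_{n-1}]. *)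
Lemma derivation_eq (D D' : 'End(Q)) : is_derivation D -> is_derivation D' ->
  D (E 0) = D' (E 0) -> D (E 1) = D' (E 1) -> forall x, D x = D' x.
Proof.
move=> hD hD' h0 h1.
have hE i : (0 < i < n)%N -> D (E i) = D' (E i).
  elim: i => [//|[|i] IH] hi; first exact: h1.
  by rewrite -lie_e0_e ?hD ?hD' ?IH ?h0 //; lia.
have hn : D (E n) = D' (E n).
  apply: oppr_inj; rewrite -!linearN -lie_e1_last /= hD hD' h1 hE //; lia.
move=> x; rewrite (Q_sum x) !linear_sum; apply: eq_bigr => i _.
rewrite !linearZ /=; congr (_ *: _); have := ltn_ord i; case: (i : nat) => [//|j] hj.
by have [->|jn] := eqVneq j.+1 n; rewrite ?hn ?hE //; lia.
Qed.

End QDerivations.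

(** * Triangular form of the derivations of Q_n *)

Section Structure.
Variables (K : fieldType) (k : nat).
Local Notation n := k.*2.+1.
Local Notation Q := (Q_alg K k).
Local Notation E i := (e_ i : Q).
Hypothesis k_gt0 : (0 < k)%N.
Variable d : 'End(Q).
Hypothesis dP : is_derivation d.
Local Notation a := (crd 0 (d (E 0))).
Local Notation b := (crd 1 (d (E 1))).

Lemma crd_e0_lie_hi (x : Q) : crd n (lie (E 0) x) = 0.
Proof. by rewrite lieC linearN /= crd_lie_e0 // ltnn andbF oppr0. Qed.

(** Obtained by differentiating [e_0, e_{n-1}] = 0 and reading coordinate n. *)
Lemma derivation_e01 : crd 1 (d (E 0)) = 0.
Proof.
have := congr1 (crd n) (dP (E 0) (E n.-1)).
rewrite lie_e0_last // !linear0 linearD /= crd_e0_lie_hi addr0.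
rewrite crd_lie_hie /=; [|lia]; rewrite -signr_odd odd_double expr0 mulN1r.
by rewrite subSnn => /esym/eqP; rewrite oppr_eq0 => /eqP.
Qed.

(** Obtained from [e_1, e_2] = 0, which fails for k = 1; there, e_1 -> e_0 does define a derivation
    ([theta_derivation]). *)
Lemma derivation_e10 : (1 < k)%N -> crd 0 (d (E 1)) = 0.
Proof.
move=> hk; have := congr1 (crd 3) (dP (E 1) (E 2)).
rewrite lie_e1_e2 // !linear0 linearD /= !crd_lie_mid; [|lia..].
by rewrite !crd_e /=; [simp0|lia..]; rewrite !mul0r subrr addr0.
Qed.

Lemma derivation_step i j : (0 < i < n.-1)%N -> (1 < j < n)%N ->
  crd j (d (E i.+1)) = a * (j.-1 == i)%:R + crd j.-1 (d (E i)).
Proof.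
move=> hi hj; rewrite -lie_e0_e // dP linearD /= !crd_lie_mid //.
rewrite !crd_e; [|lia..]; eval_bool; simp0.
by rewrite mul1r mul0r subr0.
Qed.

(** The diagonal forced by additivity along brackets from a at e_0 and b at e_1. For (a, b) = (1, 0)
    and (0, 1) these are the eigenvalues of e_{n+1} and e_{n+2} in the model. *)
Definition wt (i : nat) : K :=
  if i == 0%N then a else if (i < n)%N then i.-1%:R * a + b
  else (n - 2)%:R * a + 2 * b.

Lemma derivation_mid i : (1 < i < n)%N ->
  (forall j, (j < i)%N -> crd j (d (E i)) = 0) /\ crd i (d (E i)) = wt i.
Proof.
elim: i => [//|[//|i] IH] hi; split.
  case=> [|[|j]] hj.
  - by rewrite -lie_e0_e ?dP ?linearD /= ?crd_lie_lo ?addr0 //; lia.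
  - by rewrite -lie_e0_e ?dP ?linearD /= ?crd_lie_lo ?addr0 //; lia.
  rewrite derivation_step; [|lia..]; eval_bool; rewrite mulr0 add0r.
  case: i IH hi hj => [|i] IH hi hj; first by lia.
  by apply: (proj1 (IH _)); lia.
rewrite derivation_step; [|lia..]; rewrite eqxx mulr1 /wt /= ifT; [|lia].
case: i IH hi => [|i] IH hi; first by rewrite mul1r.
by rewrite (proj2 (IH _)) /wt /= ?ifT; [rewrite -[i.+2%:R]natr1; ring|lia..].
Qed.

Lemma derivation_last : d (E n) = wt n *: E n.
Proof.
apply: oppr_inj; rewrite -linearN -lie_e1_last //= dP.
have [h1 h2] : (forall j, (j < n.-1)%N -> crd j (d (E n.-1)) = 0)
    /\ crd n.-1 (d (E n.-1)) = wt n.-1 by apply: derivation_mid; lia.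
apply: crd_inj => j hj; rewrite linearD linearN /= crdZ crd_e // /=.
have [l1|l1] := leqP j 1; first by rewrite !crd_lie_lo //; eval_bool; simp0.
have [->|jn] := eqVneq j n.
  rewrite (lieC (E 1)) linearN /= crd_lie_e1 // eqxx ifF; [|lia].
  rewrite crd_lie_hie; [|lia]; rewrite h2 -signr_odd /= odd_double expr0 subSnn.
  rewrite /wt /= ltnn ifF; [|lia]; rewrite ifT; [|lia].
  by have -> : (n - 2 = k.*2.-1)%N by [lia]; ring.
rewrite !crd_lie_mid ?h1 ?crd_e; [|lia..]; eval_bool.
by rewrite !mulr0 ?mul0r !subr0 add0r ?mulr0 oppr0.
Qed.

(* The derivation is triangular in the basis e_1, e_0, e_2, ..., e_n. *)
Definition pos (i : nat) : nat := if (i < 2)%N then (1 - i)%N else i.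

Lemma derivation_tri i j : (i <= n)%N -> (pos j < pos i)%N -> crd j (d (E i)) = 0.
Proof.
have last i' : (1 < i' <= n)%N -> (j < i')%N -> crd j (d (E i')) = 0.
  move=> hi hj; have [->|e] := eqVneq i' n; last by apply: (proj1 (derivation_mid _)); lia.
  by rewrite derivation_last crdZ crd_e; [eval_bool; rewrite mulr0|lia].
rewrite /pos; case: i => [|[|i]] hi; case: (ltnP j 2) => hj /= h; try (exfalso; lia).
- by have -> : j = 1%N by [lia]; apply: derivation_e01.
- by apply: last; lia.
- by apply: last; lia.
Qed.

Lemma derivation_diag i : (i <= n)%N -> crd i (d (E i)) = wt i.
Proof.
move=> hi; case: i hi => [//|[|i]] hi.
  by rewrite /wt /= ifT ?mul0r ?add0r //; lia.
have [e|e] := eqVneq i.+2 n; last by apply: (proj2 (derivation_mid _)); lia.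
by rewrite e derivation_last crdZ crd_e // eqxx mulr1.
Qed.

Lemma crd_derivation j x : crd j (d x) = \sum_(i < n.+1) crd i x * crd j (d (E i)).
Proof.
rewrite {1}(Q_sum x) !linear_sum; apply: eq_bigr => i _.
by rewrite linearZ linearZ.
Qed.

(** The decreasing flag of the order e_1, e_0, e_2, ..., e_n: everything at j = 0, zero at j = n +
    1. *)
Definition flag (j : nat) (x : Q) := forall i, (i <= n)%N -> (pos i < j)%N -> crd i x = 0.

(** If a = b = 0 the whole diagonal [wt] vanishes, so the triangular matrix is strictly
    triangular. *)
Lemma flag_nil_derivation j x : a = 0 -> b = 0 -> flag j x -> flag j.+1 (d x).
Proof.
move=> a0 b0 fx i hi hj; rewrite crd_derivation big1 // => l _; have hl := ltn_ord l.
have [h|h] := ltnP (pos l) j; first by rewrite fx ?mul0r.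
have [h'|h'] := ltnP (pos i) (pos l).
  by rewrite (derivation_tri (i := l)) ?mulr0 //; lia.
have -> : i = l by move: h' h hj; rewrite /pos; case: (ltnP i 2); case: (ltnP l 2) => /=; lia.
by rewrite derivation_diag // /wt a0 b0 !mulr0 !addr0 !if_same mulr0.
Qed.

End Structure.

(** * Outer derivations of Q_n commuting with a given one *)

Section Outer.
Variables (K : fieldType) (k : nat).
Local Notation n := k.*2.+1.
Local Notation Q := (Q_alg K k).
Local Notation E i := (e_ i : Q).
Hypothesis k_gt0 : (0 < k)%N.
Hypothesis two_neq0 : 2 != 0 :> K.

Definition vec (u : nat -> K) : Q := \row_(i < n.+1) u i.

Lemma crd_vec u i : (i <= n)%N -> crd i (vec u) = u i.
Proof. by move=> hi; rewrite /crd mxE inordK. Qed.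

Definition rank1 (i : nat) (v x : Q) : Q := crd i x *: v.

Lemma rank1_linear i v : linear (rank1 i v).
Proof. by move=> c x y; rewrite /rank1 linearP scalerDl scalerA. Qed.

HB.instance Definition _ i v := GRing.isLinear.Build K Q Q *:%R
  (rank1 i v) (rank1_linear i v).

Definition rank1_der i v : 'End(Q) := linfun (rank1 i v).

Lemma rank1_derE i v x : rank1_der i v x = crd i x *: v.
Proof. by rewrite /rank1_der lfunE. Qed.

(** Such a map kills [Q, Q] since i <= 1, and the two terms of the Leibniz rule are opposite
    multiples of [w]. *)
Lemma rank1_derivation i (v w : Q) : (i <= 1)%N ->
  (forall x, lie v x = crd i x *: w) -> is_derivation (rank1_der i v).
Proof.
move=> hi hv x y; rewrite !rank1_derE crd_lie_lo // scale0r.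
by rewrite linearZl_LR linearZr_LR /= (lieC x v) !hv scalerN !scalerA mulrC subrr.
Qed.

Definition scale_weights (u : nat -> K) (x : Q) : Q := vec (fun i => u i * crd i x).

Lemma scale_weights_linear u : linear (scale_weights u).
Proof. by move=> c x y; apply/rowP => i; rewrite !mxE linearP /= mulrDr mulrCA. Qed.

HB.instance Definition _ u := GRing.isLinear.Build K Q Q *:%R
  (scale_weights u) (scale_weights_linear u).

Definition diag_der u : 'End(Q) := linfun (scale_weights u).

Lemma crd_diag_der u i x : (i <= n)%N -> crd i (diag_der u x) = u i * crd i x.
Proof. by move=> hi; rewrite /diag_der lfunE /= crd_vec. Qed.

(** The hypotheses express that [u] is additive along the nonzero brackets, that is, a grading. *)
Lemma diag_derivation (u : nat -> K) :
  (forall i, (1 < i < n)%N -> u i = u 0%N + u i.-1) ->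
  (forall i, (0 < i < n)%N -> u n = u i + u (n - i)%N) ->
  is_derivation (diag_der u).
Proof.
move=> h1 h2 x y; apply: crd_inj => i hi; rewrite linearD /= crd_diag_der //.
have [l1|l1] := leqP i 1; first by rewrite !crd_lie_lo // mulr0 addr0.
have [->|ni] := eqVneq i n.
  rewrite !crd_lie_hi mulr_sumr -big_split; apply: eq_big_nat => j hj /=.
  by rewrite !crd_diag_der; [rewrite (h2 j hj); ring|lia..].
by rewrite !crd_lie_mid ?crd_diag_der; [rewrite (h1 i); [ring|]|..]; lia.
Qed.

Section Commuting.
Variable d : 'End(Q).
Hypothesis dP : is_derivation d.
Local Notation a := (crd 0 (d (E 0))).
Local Notation b := (crd 1 (d (E 1))).

(* Derivations commuting with [d] up to inner ones are those that extend to
   the semidirect product of [Q_alg K k] by [d]. *)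
Hypothesis dmax : forall (D : 'End(Q)) m, is_derivation D ->
  (forall x, D (d x) = d (D x) + lie m x) ->
  exists r mu, forall x, D x = lie r x + mu *: d x.

(** [D, d] and [ad m] are both derivations, so it is enough to compare them on the generators e_0
    and e_1. *)
Lemma commuting_inner (D : 'End(Q)) m : is_derivation D ->
  D (d (E 0)) = d (D (E 0)) + lie m (E 0) ->
  D (d (E 1)) = d (D (E 1)) + lie m (E 1) ->
  exists r mu, forall x, D x = lie r x + mu *: d x.
Proof.
move=> hD h0 h1; apply: (dmax (m := m)) (hD) _ => x.
have comm (y : Q) : ((D \o d) - (d \o D))%VF y = ad m y <-> D (d y) = d (D y) + lie m y.
  rewrite add_lfunE opp_lfunE !comp_lfunE adE; split=> [/eqP|->]; last by rewrite addrAC subrr add0r.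
  by rewrite subr_eq addrC => /eqP.
apply/comm; apply: derivation_eq => //; [|exact: ad_derivation|exact/comm|exact/comm].
exact: derivation_comm hD dP.
Qed.

Lemma lie_en (x : Q) : lie (E n) x = 0.
Proof.
rewrite lieC; apply/eqP; rewrite oppr_eq0; apply/eqP; apply: crd_inj => i hi.
rewrite linear0; have [l1|l1] := leqP i 1; first by rewrite !crd_lie_lo.
have [->|ni] := eqVneq i n.
  rewrite crd_lie_hi big_nat_cond big1 // => j hj; rewrite crd_e; last by lia.
  by eval_bool; rewrite mulr0.
by rewrite !crd_lie_mid ?crd_e; [|lia..]; eval_bool; rewrite !mulr0 subrr.
Qed.

(** Inner derivations have zero entries at e_0 and e_1, hence mu * a = mu * b = 0. *)
Lemma inner_mod_der_eq0 D r mu : (a != 0) || (b != 0) ->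
  (forall x, D x = lie r x + mu *: d x) ->
  crd 0 (D (E 0)) = 0 -> crd 1 (D (E 1)) = 0 -> forall x, D x = lie r x.
Proof.
move=> ab h h0 h1 x; suff mu0 : mu = 0 by rewrite h mu0 scale0r addr0.
move: h0 h1; rewrite !h !linearD /= !crdZ !crd_lie_lo // !add0r.
move=> /eqP + /eqP; rewrite !mulf_eq0; case: (mu =P 0) => //= _ ha hb.
by rewrite ha hb in ab.
Qed.

(** If the weights of e_0 and e_n agreed, the derivation e_0 -> e_n would commute with [d] up to an
    inner one. It is not inner, since brackets with e_0 have no e_n component. *)
Lemma no_resonance_phi : (a != 0) || (b != 0) -> wt d n - a != 0.
Proof.
move=> ab; apply/negP; rewrite subr_eq0 => /eqP W.
have [||| r [mu h]] := @commuting_inner (rank1_der 0 (E n))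
    (* [e_{n-1}, e_1] = e_n and [e_{n-1}, e_0] = 0, so a multiple of e_{n-1} corrects the
       discrepancy at e_1 alone. *)
    (vec (fun i => if i == n.-1 then crd 0 (d (E 1)) else 0)).
- by apply: (@rank1_derivation _ _ 0) => // x; rewrite lie_en scaler0.
- rewrite !rank1_derE crd_e // scale1r derivation_last // W.
  apply: crd_inj => i hi; rewrite linearD /= crd_lie_e0 // !crdZ.
  rewrite crd_vec; [|lia]; rewrite [X in _ + X](_ : _ = 0) ?addr0 //.
  by case_ifs; rewrite ?oppr0.
- rewrite !rank1_derE crd_e // scale0r linear0 add0r.
  apply: crd_inj => i hi; rewrite crd_lie_e1 // crdZ crd_e // !crd_vec; [|lia..].
  have [->|ni] := eqVneq i n; first by rewrite ifF ?eqxx ?mulr1 //; lia.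
  by rewrite mulr0; case_ifs.
have := congr1 (crd n) (inner_mod_der_eq0 ab h _ _ (E 0)).
rewrite !rank1_derE !crdZ !crd_e // crd_lie_e0 // ltnn andbF eqxx; eval_bool.
rewrite mulr1 !mulr0 => /(_ erefl erefl)/eqP; by rewrite oner_eq0.
Qed.

Lemma lie_en1 (x : Q) : lie (E n.-1) x = crd 1 x *: E n.
Proof.
apply: crd_inj => i hi; rewrite crdZ crd_e //.
have [l1|l1] := leqP i 1; first by rewrite !crd_lie_lo //; eval_bool; rewrite mulr0.
have [->|ni] := eqVneq i n.
  rewrite lieC linearN /= crd_lie_hie; last by lia.
  by rewrite -signr_odd odd_double expr0 mulN1r opprK subSnn mulr1.
by rewrite !crd_lie_mid ?crd_e; [|lia..]; eval_bool; rewrite /= !mulr0 !mul0r subrr.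
Qed.

(** If a = 0, then e_1 and e_{n-1} have the same weight b, and e_1 -> e_{n-1} commutes with [d] up
    to an inner derivation. It is not inner: [r, e_1] lies in the span of e_2 and e_n, and n - 1 >
    2. *)
Lemma no_resonance_psi : (1 < k)%N -> b != 0 -> a != 0.
Proof.
move=> hk b0; apply/negP => /eqP a0.
have a1 := derivation_e01 k_gt0 dP.
have [m1 m2] := derivation_mid k_gt0 dP (i := n.-1) ltac:(lia).
have [||| r [mu h]] := @commuting_inner (rank1_der 1 (E n.-1))
    (- crd n (d (E n.-1)) *: E n.-1).
- by apply: (@rank1_derivation _ _ (E n)) => // x; apply: lie_en1.
- rewrite !rank1_derE crd_e // a1 !scale0r linear0 add0r.
  by rewrite linearZl_LR /= lie_en1 crd_e // scale0r scaler0.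
- rewrite !rank1_derE crd_e // scale1r linearZl_LR /= lie_en1 ?crd_e // ?eqxx.
  apply: crd_inj => i hi; rewrite linearD /= !crdZ !crd_e //.
  have [->|ni] := eqVneq i n; first by eval_bool; rewrite !mulr1 mulr0 addrN.
  have [->|nj] := eqVneq i n.-1.
    rewrite m2 /wt a0; case_ifs; eval_bool; rewrite /= !mulr0 !mulr1 ?mulr0 !addr0 ?add0r //.
  have [il|il] := ltnP i n.-1; last by lia.
  by rewrite m1 // !mulr0 addr0.
have := congr1 (crd n.-1) (inner_mod_der_eq0 _ h _ _ (E 1)).
rewrite !rank1_derE !crdZ !crd_e ?eqxx ?b0 ?orbT //; [|lia..].
rewrite crd_lie_e1 ?ifF; [|lia..]; eval_bool; rewrite mulr0 mulr1.
by move=> /(_ isT erefl (mulr0 _))/eqP; rewrite oner_eq0.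
Qed.

(** If a were nonzero, the grading 0, 1, ..., 1, 2, corrected by a multiple of e_0 -> e_n, would
    commute with [d] up to an inner derivation. Its entry 0 at e_0 forces mu = 0, and then its entry
    1 at e_1 is impossible for an inner derivation. *)
Lemma no_generic : (1 < k)%N -> wt d n - a != 0 -> a = 0.
Proof.
move=> hk W; apply/eqP/negPn/negP => a0.
have a1 := derivation_e01 k_gt0 dP.
have b1 := derivation_e10 k_gt0 dP hk.
pose u (i : nat) : K := if i == 0%N then 0 else if (i < n)%N then 1 else 2.
(* [r0] solves the e_n coordinate of the commutation relation at e_0, which no inner derivation can
   adjust. *)
pose r0 := 2 * crd n (d (E 0)) / (wt d n - a).
(* The coordinates of [c] below n-1 correct the relation at e_0, and coordinate n-1 corrects it at
   e_1. *)
pose c (i : nat) : K := if i == 0%N then 0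
  else if i == n.-1 then crd n (d (E 1)) else - crd i.+1 (d (E 0)).
pose D := diag_der u + r0 *: rank1_der 0 (E n).
have DE i x : (i <= n)%N -> crd i (D x) = u i * crd i x + r0 * (crd 0 x * (i == n)%:R).
  by move=> hi; rewrite add_lfunE scale_lfunE rank1_derE linearD /= !crdZ crd_diag_der // crd_e.
have De0 : D (E 0) = r0 *: E n.
  apply: crd_inj => i hi; rewrite DE // crdZ !crd_e // mul1r.
  by rewrite /u; case: eqP => e; rewrite ?mul0r ?mulr0 add0r.
have De1 : D (E 1) = E 1.
  apply: crd_inj => i hi; rewrite DE // !crd_e // mul0r mulr0 addr0.
  have [->|i1] := eqVneq i 1%N; last by rewrite mulr0.
  by rewrite mulr1 /u /= ifT //; lia.
have [||| r [mu h]] := @commuting_inner D (vec c).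
- apply: derivationD; last apply: derivationZ.
    by apply: diag_derivation => i hi; rewrite /u; case_ifs; ring.
  by apply: (@rank1_derivation _ _ 0) => // x; rewrite lie_en scaler0.
- rewrite De0 linearZ /= derivation_last //.
  apply: crd_inj => i hi; rewrite DE // linearD /= !crdZ crd_lie_e0 // crd_e //.
  have [->|ni] := eqVneq i n.
    by rewrite ltnn andbF /u ltnn /= /r0; field.
  rewrite !mulr0 add0r addr0; case: ifP => h; last first.
    rewrite /u; case: eqP => [->|i0]; first by rewrite mul0r.
    by have -> : i = 1%N by [lia]; rewrite a1 mulr0.
  rewrite crd_vec; [|lia]; rewrite /c /u; case_ifs.
  by rewrite opprK mul1r; congr (crd _ _); lia.
- rewrite De1; apply: crd_inj => i hi; rewrite DE // b1 mul0r mulr0 addr0 linearD /=.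
  rewrite crd_lie_e1 // !crd_vec; [|lia..].
  have [->|ni] := eqVneq i n; first by rewrite /u /c eqxx ltnn; case_ifs; ring.
  have [->|i2] := eqVneq i 2%N; first by rewrite /u /c; case_ifs; ring.
  rewrite addr0 /u; case: eqP => [->|i0]; first by rewrite mul0r b1.
  by rewrite ifT ?mul1r //; lia.
have : mu = 0.
  have := congr1 (crd 0) (h (E 0)); rewrite De0 linearD /= !crdZ crd_e // crd_lie_lo //.
  by rewrite mulr0 add0r => /esym/eqP; rewrite mulf_eq0 (negbTE a0) orbF => /eqP.
move=> mu0; have := congr1 (crd 1) (h (E 1)).
by rewrite De1 mu0 scale0r addr0 crd_e // crd_lie_lo // => /eqP; rewrite oner_eq0.
Qed.

Lemma lie_e0_k1 (x : Q) : k = 1%N -> lie (E 0) x = crd 1 x *: E 2.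
Proof.
move=> k1; apply: crd_inj => i hi; rewrite lieC linearN /= crd_lie_e0 // crdZ crd_e //.
have [->|i2] := eqVneq i 2%N; first by rewrite ifT ?opprK ?mulr1 //; lia.
by rewrite ifF ?oppr0 ?mulr0 //; lia.
Qed.

Lemma crd3_k1 (x : Q) : k = 1%N -> crd 3 x = crd n x.
Proof. by move=> k1; congr (crd _ _); lia. Qed.

Lemma theta_derivation : k = 1%N -> is_derivation (rank1_der 1 (E 0)).
Proof. by move=> k1; apply: (@rank1_derivation _ _ (E 2)) => // x; apply: lie_e0_k1. Qed.

(** If a = b, the derivation e_1 -> e_0 commutes with [d] up to an inner one. It is not inner, as
    its image is not in [Q, Q]. *)
Lemma no_resonance_theta : k = 1%N -> b != 0 -> a != b.
Proof.
move=> k1 b0; apply/negP => /eqP ab.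
have a1 := derivation_e01 k_gt0 dP.
pose c (i : nat) : K := if i == 0%N then - crd 2 (d (E 0))
  else if i == 2%N then - crd 3 (d (E 0)) else 0.
have [||| r [mu h]] := @commuting_inner (rank1_der 1 (E 0)) (vec c).
- exact: theta_derivation.
- rewrite !rank1_derE crd_e // a1 !scale0r linear0 add0r.
  apply: crd_inj => i hi; rewrite crd_lie_e0 // linear0; case: ifP => // h.
  by rewrite crd_vec ?/c; [case_ifs; rewrite oppr0|lia].
- rewrite !rank1_derE crd_e // scale1r.
  apply: crd_inj => i hi; rewrite linearD /= crdZ crd_lie_e1 // crd_e // !crd_vec; [|lia..].
  have [->|i0] := eqVneq i 0%N; first by rewrite mulr1 ab /= addr0.
  rewrite mulr0 /c; have [->|i1] := eqVneq i 1%N; first by rewrite a1 add0r ifF //; lia.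
  have [->|i2] := eqVneq i 2%N; first by rewrite addrN.
  have -> : i = n by lia.
  by rewrite eqxx ifF ?ifT; [rewrite crd3_k1 // addrN|lia..].
have := congr1 (crd 0) (inner_mod_der_eq0 _ h _ _ (E 1)).
rewrite !rank1_derE !crdZ !crd_e // crd_lie_lo // b0 orbT.
by move=> /(_ isT (mul0r _) (mulr0 _))/eqP; rewrite mulr1 oner_eq0.
Qed.

(** Counterpart of [no_generic] for k = 1, with the grading 1, 0, 1, 1 corrected by a multiple of
    e_1 -> e_0; the entry 0 at e_1 now forces mu = 0, against the entry 1 at e_0. *)
Lemma no_generic_k1 : k = 1%N -> a != b -> b = 0.
Proof.
move=> k1 ab; apply/eqP/negPn/negP => b0.
have a1 := derivation_e01 k_gt0 dP.
pose u (i : nat) : K := if i == 1%N then 0 else 1.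
(* [q] solves coordinate 0 of the commutation relation at e_1, where brackets vanish. *)
pose q := crd 0 (d (E 1)) / (a - b).
pose D := diag_der u + q *: rank1_der 1 (E 0).
have ab' : a - b != 0 by rewrite subr_eq0.
have DE i x : (i <= n)%N -> crd i (D x) = u i * crd i x + q * (crd 1 x * (i == 0%N)%:R).
  by move=> hi; rewrite add_lfunE scale_lfunE rank1_derE linearD /= !crdZ crd_diag_der // crd_e.
have De0 : D (E 0) = E 0.
  apply: crd_inj => i hi; rewrite DE // !crd_e // mul0r mulr0 addr0.
  have [->|i0] := eqVneq i 0%N; last by rewrite mulr0.
  by rewrite mulr1.
have De1 : D (E 1) = q *: E 0.
  apply: crd_inj => i hi; rewrite DE // crdZ !crd_e // mul1r.
  by rewrite /u; case: eqP => e; rewrite ?mul0r ?mulr0 add0r.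
pose c (i : nat) : K := if i == 0%N then crd 2 (d (E 1)) - q * crd 2 (d (E 0))
  else if i == 2%N then crd 3 (d (E 1)) - q * crd 3 (d (E 0)) else 0.
have [||| r [mu h]] := @commuting_inner D (vec c).
- apply: derivationD; last by apply: derivationZ; apply: theta_derivation.
  by apply: diag_derivation => i hi; rewrite /u; case_ifs; ring.
- rewrite De0; apply: crd_inj => i hi; rewrite DE // a1 mul0r mulr0 addr0 linearD /=.
  rewrite crd_lie_e0 // [X in _ + X](_ : _ = 0) ?addr0; last first.
    by case: ifP => // h; rewrite crd_vec ?/c; [case_ifs; rewrite oppr0|lia].
  by rewrite /u; case: eqP => [->|_]; rewrite ?mul0r ?a1 // mul1r.
- rewrite De1 linearZ /=; apply: crd_inj => i hi; rewrite DE // linearD /= crdZ crd_lie_e1 //.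
  rewrite !crd_vec; [|lia..].
  have [->|i0] := eqVneq i 0%N.
    by rewrite /u /= /q; field.
  rewrite !mulr0 addr0 /u /c; have [->|i1] := eqVneq i 1%N.
    by rewrite a1 mulr0 mul0r add0r ifF //; lia.
  have [->|i2] := eqVneq i 2%N; first by rewrite /=; ring.
  have -> : i = n by lia.
  rewrite eqxx ifF ?ifT ?crd3_k1; [ring|lia..].
have mub : mu * b = 0.
  by have := congr1 (crd 1) (h (E 1)); rewrite De1 linearD /= !crdZ crd_e // mulr0 crd_lie_lo // add0r.
move: mub => /eqP; rewrite mulf_eq0 (negbTE b0) orbF => /eqP mu0.
have := congr1 (crd 0) (h (E 0)).
by rewrite De0 mu0 scale0r addr0 crd_e // crd_lie_lo // => /eqP; rewrite oner_eq0.
Qed.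

(** For k = 1 the difference of the weights of e_n and e_0 is 2b, so b is nonzero and the two
    statements on e_1 -> e_0 clash. For k > 1, [no_generic] gives a = 0, which [no_resonance_psi]
    excludes. *)
Lemma commuting_trivial : a = 0 /\ b = 0.
Proof.
have [ab|] := boolP ((a != 0) || (b != 0)); last first.
  by rewrite negb_or !negbK => /andP[/eqP -> /eqP ->].
have W := no_resonance_phi ab; exfalso.
have [k1|k1] := leqP k 1.
  have k1' : k = 1%N by lia.
  have b0 : b != 0.
    apply: contraNneq W => b0; rewrite /wt /= ltnn b0 mulr0 addr0.
    by have -> : (n - 2 = 1)%N by [lia]; rewrite mul1r subrr.
  by move/eqP: (b0); apply; apply: no_generic_k1 => //; apply: no_resonance_theta.
have a0 := no_generic k1 W.
by move: ab (no_resonance_psi k1); rewrite a0 eqxx /= => b0 /(_ b0).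
Qed.

End Commuting.
End Outer.

(** * The centralizer of the nilradical in a solvable Lie algebra *)

Section Nilradical.
Variables (K : fieldType) (L : lieAlgType K).
Implicit Types (U V W N : {vspace L}).

Lemma lie_prod_ind U V (P : L -> Prop) : P 0 ->
  (forall c x y, P x -> P y -> P (c *: x + y)) ->
  (forall u v, u \in U -> v \in V -> P (lie u v)) ->
  forall w, w \in lie_prod U V -> P w.
Proof.
move=> P0 PD Pl w.
rewrite /lie_prod; set s := [seq lie u v | u <- vbasis U, v <- vbasis V] => hw.
rewrite (coord_span (X := in_tuple s) hw).
elim/big_rec: _ => // i x _ Px; apply: PD Px.
have /allpairsP[[u v] /= [hu hv ->]] := mem_nth 0 (ltn_ord i : (i < size s)%N).
by apply: Pl; apply: vbasis_mem.
Qed.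

Lemma lie_prod_sub U V W : (forall u v, u \in U -> v \in V -> lie u v \in W) ->
  (lie_prod U V <= W)%VS.
Proof.
move=> h; apply/subvP; apply: (lie_prod_ind (P := fun w => w \in W)) => //; first exact: mem0v.
by move=> c x y hx hy; rewrite memvD // memvZ.
Qed.

Lemma mem_lie_prod U V u v : u \in U -> v \in V -> lie u v \in lie_prod U V.
Proof.
move=> /coord_vbasis -> /coord_vbasis ->.
rewrite linear_sumlz; apply: memv_suml => i _ /=.
rewrite linear_sumr; apply: memv_suml => j _ /=.
rewrite linearZl_LR linearZr_LR /=; do 2! apply: memvZ.
by apply: memv_span; apply: allpairs_f; apply: mem_nth; rewrite size_tuple.
Qed.

Lemma lie_prodS U U' V V' : (U <= U')%VS -> (V <= V')%VS ->
  (lie_prod U V <= lie_prod U' V')%VS.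
Proof.
by move=> /subvP hU /subvP hV; apply: lie_prod_sub => u v /hU ? /hV; apply: mem_lie_prod.
Qed.

Lemma lie_ideal_prod U V : lie_ideal U -> lie_ideal V -> lie_ideal (lie_prod U V).
Proof.
move=> hU hV x y; move: y; apply: (lie_prod_ind (P := fun y => lie x y \in lie_prod U V)) => [|c y z hy hz|u v hu hv].
- by rewrite linear0 mem0v.
- by rewrite linearP memvD // memvZ.
have := ad_derivation x u v; rewrite !adE => ->.
by rewrite memvD // mem_lie_prod ?hU ?hV.
Qed.

Lemma lie_ideal_derived U m : lie_ideal U -> lie_ideal (derived_series U m).
Proof. by move=> hU; elim: m => //= m IH; apply: lie_ideal_prod. Qed.

Lemma derived_series_sub U m : lie_ideal U -> (derived_series U m <= U)%VS.
Proof.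
move=> hU; elim: m => [|m IH] /=; first exact: subvv.
by apply: lie_prod_sub => u v _ hv; apply: hU; apply: (subvP IH).
Qed.

Lemma derived_seriesS U V m : (U <= V)%VS -> (derived_series U m <= derived_series V m)%VS.
Proof. by move=> h; elim: m => //= m IH; apply: lie_prodS. Qed.

(** Composing with the projection onto [N] makes vanishing on [N] an equation between endomorphisms,
    so that the centralizer is the kernel of a linear map. *)
Definition ad_on N (v : L) : 'End(L) := (ad v \o projv N)%VF.

Lemma ad_on_linear N : linear (ad_on N).
Proof.
move=> c u v; apply/lfunP => x.
by rewrite add_lfunE scale_lfunE !comp_lfunE !adE linearPl.
Qed.

HB.instance Definition _ N := GRing.isLinear.Build K L 'End(L) *:%R
  (ad_on N) (ad_on_linear N).

Definition centralizer N : {vspace L} := lker (linfun (ad_on N)).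

Lemma centralizerP N v : reflect (forall x, x \in N -> lie v x = 0) (v \in centralizer N).
Proof.
rewrite memv_ker lfunE; apply: (iffP eqP) => [h x hx|h].
  by have := congr1 (fun F : 'End(L) => F x) h; rewrite /= comp_lfunE adE projv_id // zero_lfunE.
by apply/lfunP => x; rewrite comp_lfunE adE zero_lfunE h // memv_proj.
Qed.

Lemma lie_ideal_centralizer N : lie_ideal N -> lie_ideal (centralizer N).
Proof.
move=> hN x y /centralizerP hy; apply/centralizerP => z hz.
have := ad_derivation x y z; rewrite !adE !hy // ?linear0 ?addr0; last exact: hN.
by [].
Qed.

(* The last term of the derived series of the centralizer not contained in the
   nilradical is a nilpotent ideal of class two. *)
Lemma centralizer_nilradical N : lie_solvable L -> is_nilradical N ->
  (centralizer N <= N)%VS.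
Proof.
move=> [m0 hm0] [hN _ maxN]; set C := centralizer N.
have hC : lie_ideal C by apply: lie_ideal_centralizer.
have ex : exists m, (derived_series C m <= N)%VS.
  exists m0; apply: subv_trans (derived_seriesS m0 (subvf C)) _.
  by rewrite hm0 sub0v.
case: (ex_minnP ex) => [[|m]] //= hm minm.
suff : (derived_series C m <= N)%VS by move/minm; rewrite ltnn.
apply: maxN; first exact: lie_ideal_derived.
exists 2%N => /=; apply/eqP; rewrite -subv0; apply: lie_prod_sub => u v hu hv.
have /centralizerP -> // : u \in C by apply: (subvP (derived_series_sub m hC)).
  exact: mem0v.
exact: (subvP hm).
Qed.

End Nilradical.

(** * Complete solvable Lie algebras with nilradical Q_n *)

Section NilradicalQ.
Variables (K : fieldType) (k : nat) (g : lieAlgType K) (N : {vspace g}).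
Local Notation n := k.*2.+1.
Local Notation Q := (Q_alg K k).
Local Notation E i := (e_ i : Q).
Hypothesis k_gt0 : (0 < k)%N.
Hypothesis two_neq0 : 2 != 0 :> K.
Hypothesis complete : lie_complete g.
Hypothesis solvable : lie_solvable g.
Hypothesis nilradical : is_nilradical N.
Variable f : 'Hom(Q, g).
Hypothesis f_inj : lker f = 0%VS.
Hypothesis f_img : limg f = N.
Hypothesis f_lie : forall x y : Q, f (lie x y) = lie (f x) (f y).

Lemma fV q : (f^-1)%VF (f q) = q.
Proof. by apply: lker0_lfunK; rewrite f_inj. Qed.

Lemma fI : injective f.
Proof. exact: can_inj fV. Qed.

Lemma mem_f q : f q \in N.
Proof. by rewrite -f_img memv_img ?memvf. Qed.

Lemma fVK v : v \in N -> f ((f^-1)%VF v) = v.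
Proof. by rewrite -f_img => hv; rewrite limg_lfunVK. Qed.

Lemma idealN : lie_ideal N.
Proof. by case: nilradical. Qed.

Definition act v : 'End(Q) := ((f^-1) \o ad v \o f)%VF.

Lemma f_act v q : f (act v q) = lie v (f q).
Proof. by rewrite !comp_lfunE adE fVK //; apply: idealN; apply: mem_f. Qed.

Lemma act_derivation v : is_derivation (act v).
Proof.
move=> x y; apply: fI; rewrite f_act linearD /= !f_lie !f_act.
by have := ad_derivation v (f x) (f y); rewrite !adE.
Qed.

Lemma act_linear q : linear (fun v => act v q).
Proof. by move=> c u v; apply: fI; rewrite linearP /= !f_act linearPl. Qed.

Lemma act_f p q : act (f p) q = lie p q.
Proof. by apply: fI; rewrite f_act f_lie. Qed.

Lemma act_lie u v q : act (lie u v) q = act u (act v q) - act v (act u q).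
Proof.
apply: fI; rewrite linearB /= !f_act.
apply/eqP; rewrite eq_sym subr_eq; apply/eqP.
by have := ad_derivation u v (f q); rewrite !adE.
Qed.

Definition weight0 v : K^o := crd 0 (act v (E 0)).
Definition weight1 v : K^o := crd 1 (act v (E 1)).

Lemma weight0_linear : linear weight0.
Proof. by move=> c u v; rewrite /weight0 act_linear linearP. Qed.

Lemma weight1_linear : linear weight1.
Proof. by move=> c u v; rewrite /weight1 act_linear linearP. Qed.

HB.instance Definition _ := GRing.isLinear.Build K g K^o *:%R weight0 weight0_linear.
HB.instance Definition _ := GRing.isLinear.Build K g K^o *:%R weight1 weight1_linear.

Lemma weight0_f q : weight0 (f q) = 0.
Proof. by rewrite /weight0 act_f crd_lie_lo. Qed.

Lemma weight1_f q : weight1 (f q) = 0.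
Proof. by rewrite /weight1 act_f crd_lie_lo. Qed.

Lemma crd0_act v q :
  crd 0 (act v q) = crd 0 q * weight0 v + crd 1 q * crd 0 (act v (E 1)).
Proof.
rewrite crd_derivation big_ord_recl /= big_ord_recl /= big1 => [|i _].
  by rewrite addr0.
rewrite (derivation_tri k_gt0 (act_derivation v)) ?mulr0 //=; have := ltn_ord i; rewrite /bump /pos /=; lia.
Qed.

Lemma crd1_act v q : crd 1 (act v q) = crd 1 q * weight1 v.
Proof.
rewrite crd_derivation big_ord_recl /= big_ord_recl /= big1 => [|i _].
  by rewrite (derivation_e01 k_gt0 (act_derivation v)) mulr0 add0r addr0.
rewrite (derivation_tri k_gt0 (act_derivation v)) ?mulr0 //=; have := ltn_ord i; rewrite /bump /pos /=; lia.
Qed.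

(** On Q / [Q, Q] the action is by triangular 2x2 matrices in the basis e_1, e_0, and a commutator
    of such matrices has zero diagonal. *)
Lemma weight0_lie u v : weight0 (lie u v) = 0.
Proof.
rewrite {1}/weight0 act_lie linearB /=.
rewrite !(crd0_act _ (act _ _)).
rewrite !derivation_e01; try done; try exact: act_derivation.
by rewrite !mul0r !addr0 -!/(weight0 _) mulrC subrr.
Qed.

Lemma weight1_lie u v : weight1 (lie u v) = 0.
Proof.
rewrite {1}/weight1 act_lie linearB /= !(crd1_act _ (act _ _)) -!/(weight1 _).
by rewrite mulrC subrr.
Qed.

Lemma flag0 j : flag j (0 : Q).
Proof. by move=> i _ _; rewrite linear0. Qed.

Lemma flagP j c (x y : Q) : flag j x -> flag j y -> flag j (c *: x + y).
Proof. by move=> hx hy i hi hj; rewrite linearP /= hx // hy // scaler0 addr0. Qed.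

Lemma flag_eq0 (x : Q) : flag n.+1 x -> x = 0.
Proof.
move=> hx; apply: crd_inj => i hi; rewrite linear0 hx // /pos; case: ifP; lia.
Qed.

Definition weightless : {vspace g} := (lker (linfun weight0) :&: lker (linfun weight1))%VS.

Lemma weightlessP v : v \in weightless <-> weight0 v = 0 /\ weight1 v = 0.
Proof.
rewrite memv_cap !memv_ker !lfunE /=.
by split=> [/andP[/eqP -> /eqP ->]|[-> ->]]; rewrite ?eqxx.
Qed.

Lemma weightless_act u j q : u \in weightless -> flag j q -> flag j.+1 (act u q).
Proof.
by move=> /weightlessP[u0 u1]; apply: flag_nil_derivation => //; apply: act_derivation.
Qed.

(** Each factor of an iterated bracket of weightless elements moves the flag by one step. *)
Lemma lower_central_act m v : v \in lower_central weightless m ->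
  forall j q, flag j q -> flag (j + m.+1) (act v q).
Proof.
elim: m v => [|m IH] /=.
  by move=> v hv j q; rewrite addn1; apply: weightless_act.
apply: lie_prod_ind => [|c u v hu hv|u v hu hv] j q hq.
- suff -> : act 0 q = 0 by apply: flag0.
  by apply: fI; rewrite f_act linear0 linear0l.
- by rewrite act_linear; apply: flagP; [apply: hu|apply: hv].
rewrite act_lie addnS -scaleN1r addrC; apply: flagP.
  by rewrite -addSn; apply: IH => //; apply: weightless_act.
by apply: weightless_act => //; apply: IH.
Qed.

(** At index n the action on Q_n is already zero, so the element centralizes [N] and hence belongs
    to it. Each further bracket then moves it one step down the flag. *)
Lemma lower_central_f m v : v \in lower_central weightless (n + m) ->
  exists2 q, v = f q & flag m q.
Proof.
elim: m v => [|m IH] v.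
  rewrite addn0 => hv; exists ((f^-1)%VF v) => //; rewrite fVK //.
  apply: (subvP (centralizer_nilradical solvable nilradical)).
  apply/centralizerP => x hx; rewrite -(fVK hx) -f_act.
  have -> : act v ((f^-1)%VF x) = 0; last by rewrite linear0.
  by apply: flag_eq0; apply: (lower_central_act hv (j := 0)).
rewrite addnS /=; move: v; apply: lie_prod_ind => [|c _ _ [p -> hp] [q -> hq]|u v hu /IH [q -> hq]].
- by exists 0; [rewrite linear0|apply: flag0].
- by exists (c *: p + q); [rewrite linearP|apply: flagP].
by exists (act u q); [rewrite f_act|apply: weightless_act].
Qed.

Lemma weightless_nilradical v : weight0 v = 0 -> weight1 v = 0 -> v \in N.
Proof.
move=> h0 h1; have [_ _ maxN] := nilradical; apply: (subvP (maxN weightless _ _)).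
- by move=> x y _; apply/weightlessP; rewrite weight0_lie weight1_lie.
(* Index n brings the series into [N], and n + 1 further brackets exhaust the flag. *)
- exists (n + n.+1)%N; apply/eqP; rewrite -subv0; apply/subvP => x /lower_central_f[q -> /flag_eq0 ->].
  by rewrite linear0 mem0v.
by apply/weightlessP.
Qed.

(** * Extensions of Q_n by one element *)

Section Rank1.
Variables (x : g) (l : 'Hom(g, K^o)).
Hypothesis lx : l x = 1.
Hypothesis lf : forall q, l (f q) = 0.
Hypothesis lN : forall v, v - (l v : K) *: x \in N.

Lemma decomposition v : exists q, v = f q + (l v : K) *: x.
Proof. by exists ((f^-1)%VF (v - (l v : K) *: x)); rewrite fVK // subrK. Qed.

(** The linear map of g = f(Q) + K x that restricts to [D] on f(Q) and sends [x] to [f m]. *)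
Definition extend (D : 'End(Q)) (m : Q) (v : g) : g :=
  f (D ((f^-1)%VF (v - (l v : K) *: x))) + (l v : K) *: f m.

Lemma extend_linear D m : linear (extend D m).
Proof.
move=> c u v.
have split (lu lv : K) :
    c *: u + v - (c * lu + lv) *: x = c *: (u - lu *: x) + (v - lv *: x).
  by rewrite scalerDl scalerBr scalerA opprD addrACA.
rewrite /extend; have -> : l (c *: u + v) = c * l u + l v by rewrite linearP.
by rewrite split !linearP /= scalerDl scalerDr scalerA addrACA.
Qed.

HB.instance Definition _ D m := GRing.isLinear.Build K g g *:%R
  (extend D m) (extend_linear D m).

Lemma extendE D m q c : extend D m (f q + c *: x) = f (D q) + c *: f m.
Proof.
have lE : l (f q + c *: x) = c by rewrite linearD linearZ /= lf lx add0r [LHS]mulr1.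
by rewrite /extend lE addrK fV.
Qed.

(** The second hypothesis is the Leibniz rule for the pair formed by [x] and [f q]; on two elements
    of f(Q) the rule is that of [D]. *)
Lemma extend_derivation (D : 'End(Q)) m : is_derivation D ->
  (forall q, D (act x q) = act x (D q) + lie m q) -> is_derivation (linfun (extend D m)).
Proof.
move=> hD hm u v; rewrite !lfunE /=.
have [p ->] := decomposition u; have [q ->] := decomposition v.
move: (l u) (l v) => cu cv; rewrite !extendE.
have fC (A B C : Q) (c c' : K) : f (A + c *: B - c' *: C) = f A + c *: f B - c' *: f C.
  by rewrite linearB linearD !linearZ.
have br (p1 p2 : Q) (c1 c2 : K) : lie (f p1 + c1 *: x) (f p2 + c2 *: x)
    = f (lie p1 p2 + c1 *: act x p2 - c2 *: act x p1).
  rewrite fC f_lie !f_act linearDl !linearDr /= !linearZl_LR !linearZr_LR /= liexx !scaler0 addr0.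
  by rewrite (lieC (f p1) x) scalerN addrAC.
(* Terms in the image of [f] are padded with a zero multiple of [x], the shape that [br] and
   [extendE] expect. *)
have sh (D1 : Q) (c : K) : f D1 + c *: f m = f (D1 + c *: m) + (0 : K) *: x.
  by rewrite scale0r addr0 linearD linearZ.
have sh0 (D1 : Q) : f D1 = f D1 + (0 : K) *: x by rewrite scale0r addr0.
rewrite br !sh !br [f (lie p q + _ - _)]sh0 extendE scale0r addr0 -linearD.
congr (f _); rewrite !scale0r subr0 addr0.
rewrite linearB linearD !linearZ /= hD !hm linearDl linearDr !linearD !linearZ /=.
rewrite linearZl_LR /= (lieC p m).
(* With the brackets abstracted, a linear identity remains, checked coordinate by coordinate. *)
move: (lie (D p) q) (lie p (D q)) (act x (D q)) (act x (D p)) => A B C F.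
move: (act x m) (lie m q) (lie m p) => M Y Z.
by apply/rowP => i; rewrite !mxE; ring.
Qed.

(** Completeness makes the extension equal to [ad w]; splitting [w] as f r + mu x gives the two
    terms. *)
Lemma rank1_inner (D : 'End(Q)) m : is_derivation D ->
  (forall q, D (act x q) = act x (D q) + lie m q) ->
  exists r mu, forall q, D q = lie r q + mu *: act x q.
Proof.
move=> hD hm; have [w hw] := complete.2 _ (extend_derivation hD hm).
have [r wE] := decomposition w; exists r, (l w) => q; apply: fI.
have fE : f (D q) = extend D m (f q).
  by rewrite -[f q]addr0 -(scale0r x) extendE scale0r addr0.
rewrite fE linearD linearZ /= f_lie f_act -linearZl_LR -linearDl /= -wE -hw.
by rewrite lfunE.
Qed.
End Rank1.

(** Excludes rank one for the pair of weights. If a weight were nonzero at [x], then [l] would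
    vanish on [N] and g would be Q_n extended by [x], so [commuting_trivial] would apply to the
    action of [x]. *)
Lemma weights_dominate (x : g) (l : 'Hom(g, K^o)) :
  l x = 1 -> (forall v, weight0 v = l v * weight0 x /\ weight1 v = l v * weight1 x) ->
  weight0 x = 0 /\ weight1 x = 0.
Proof.
move=> lx lw.
have lf : (weight0 x != 0) || (weight1 x != 0) -> forall q, l (f q) = 0.
  move=> nz q; have [] := lw (f q); rewrite weight0_f weight1_f.
  move=> /esym/eqP + /esym/eqP; rewrite !mulf_eq0.
  by case/orP: nz => /negbTE ->; rewrite orbF; [move/eqP|move=> _ /eqP].
have [nz|] := boolP ((weight0 x != 0) || (weight1 x != 0)); last first.
  by rewrite negb_or !negbK => /andP[/eqP -> /eqP ->].
apply: (commuting_trivial k_gt0 two_neq0 (act_derivation x)) => D m.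
apply: (@rank1_inner x l) => //; first exact: lf.
move=> v; apply: weightless_nilradical; rewrite linearB linearZ /=.
  by rewrite (lw v).1 subrr.
by rewrite (lw v).2 subrr.
Qed.

Lemma Q_e_neq0 i : (i <= n)%N -> E i != 0.
Proof.
move=> hi; apply/eqP => /(congr1 (crd i)); rewrite crd_e // eqxx linear0 => /eqP.
by rewrite oner_eq0.
Qed.

(** By cases on the rank of the pair of weights: rank one contradicts [weights_dominate], and rank
    zero would make g equal to [N], with e_n in its center. *)
Lemma weights_onto : exists x y,
  [/\ weight0 x = 1, weight1 x = 0, weight0 y = 0 & weight1 y = 1].
Proof.
have w0P (c c' : K) u v : weight0 (c *: u + c' *: v) = c * weight0 u + c' * weight0 v.
  by rewrite linearD !linearZ.
have w1P (c c' : K) u v : weight1 (c *: u + c' *: v) = c * weight1 u + c' * weight1 v.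
  by rewrite linearD !linearZ.
have [[u [v det]]|nodet] := EM (exists u v, weight0 u * weight1 v - weight0 v * weight1 u != 0).
  pose dt : K := weight0 u * weight1 v - weight0 v * weight1 u.
  (* Cramer's rule for the matrix of the weights of [u] and [v]. *)
  exists ((weight1 v / dt : K) *: u + (- weight1 u / dt : K) *: v).
  exists ((- weight0 v / dt : K) *: u + (weight0 u / dt : K) *: v).
  by rewrite !w0P !w1P /dt; split; field.
exfalso.
have prop u v : weight0 u * weight1 v = weight0 v * weight1 u.
  by apply/eqP; rewrite -subr_eq0; apply/negPn/negP => h; apply: nodet; exists u, v.
have [[x [hx|hx]]|none] := EM (exists x, weight0 x != 0 \/ weight1 x != 0).
- pose l : 'Hom(g, K^o) := ((weight0 x)^-1 : K) *: linfun weight0.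
  have lE v : l v = (weight0 x)^-1 * weight0 v by rewrite scale_lfunE lfunE.
  have [||/eqP] := @weights_dominate x l; first by rewrite lE mulVf.
    by move=> v; rewrite lE; split; [|rewrite -mulrA -prop]; field.
  by rewrite (negbTE hx).
- pose l : 'Hom(g, K^o) := ((weight1 x)^-1 : K) *: linfun weight1.
  have lE v : l v = (weight1 x)^-1 * weight1 v by rewrite scale_lfunE lfunE.
  have [||_ /eqP] := @weights_dominate x l; first by rewrite lE mulVf.
    by move=> v; rewrite lE; split; [rewrite -mulrA [weight1 v * _]mulrC prop|]; field.
  by rewrite (negbTE hx).
have zero v : weight0 v = 0 /\ weight1 v = 0.
  by split; apply/eqP/negPn/negP => h; apply: none; exists v; [left|right].
have fn0 : f (E n) = 0.
  apply: complete.1 => y; have [y0 y1] := zero y.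
  rewrite -(fVK (weightless_nilradical y0 y1)) -f_lie lie_en ?linear0 //.
have en0 : E n = 0 :> Q by apply: fI; rewrite fn0 linear0.
by have := Q_e_neq0 (leqnn n); rewrite en0 eqxx.
Qed.

(** * An exact symplectic form without a normal form *)

Lemma frobenius : symplectic g.
Proof.
have [x [y [x0 x1 y0 y1]]] := weights_onto.
pose P v : K := crd n (act v (E 0)).
(* Chosen so that s + P x - (n - 2)/2 * P y = 1; times -2, this is the determinant of the system
   [e1], [e2] in the two weights of [z]. *)
pose s : K := 1 - P x + (n - 2)%:R / 2 * P y.
pose h : 'Hom(Q, K^o) := s *: linfun (@crd K k 0) + linfun (@crd K k n).
have hE q : h q = s * crd 0 q + crd n q by rewrite add_lfunE scale_lfunE !lfunE.
(* [f^-1] inverts [f] only on [N]; the computations below evaluate [alpha] on brackets with an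
   argument in [N], which lie in this ideal. *)
pose alpha := (h \o f^-1)%VF.
have alE z q : alpha (lie z (f q)) = s * crd 0 (act z q) + crd n (act z q).
  by rewrite -f_act comp_lfunE fV hE.
exists (lie_d alpha); apply: exact_symplectic => // z hz.
have wtE v : wt (act v) n = (n - 2)%:R * weight0 v + 2 * weight1 v.
  by rewrite /wt /= ltnn.
have actn v : act v (E n) = wt (act v) n *: E n.
  by apply: derivation_last => //; apply: act_derivation.
have [q zE] : exists q, z = f q + ((weight0 z : K) *: x + (weight1 z : K) *: y).
  exists ((f^-1)%VF (z - ((weight0 z : K) *: x + (weight1 z : K) *: y))).
  rewrite fVK ?subrK //; apply: weightless_nilradical; rewrite linearB linearD !linearZ /=.
    by rewrite x0 y0 scaler0 addr0 [_ *: _]mulr1 subrr.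
  by rewrite x1 y1 scaler0 add0r [_ *: _]mulr1 subrr.
(* The component [f q] contributes nothing, as [q, e_0] has no e_n coordinate. *)
have Pz : P z = weight0 z * P x + weight1 z * P y.
  have -> : P z = crd n (1 *: act (f q) (E 0)
      + (weight0 z *: act x (E 0) + (weight1 z *: act y (E 0) + act 0 (E 0)))).
    by rewrite -!act_linear scale1r addr0 /P -zE.
  have -> : act 0 (E 0) = 0 by apply: fI; rewrite f_act linear0 linear0l.
  rewrite act_f scale1r addr0 !linearD /= !crdZ crd_lie_e0 // ltnn andbF add0r //.
(* Pairing [z] with e_n, then with e_0, gives two equations for its weights. *)
have e1 : (n - 2)%:R * weight0 z + 2 * weight1 z = 0.
  have := hz (f (E n)); rewrite alE actn !crdZ !crd_e // eqxx mulr0 mulr0 mulr1 add0r.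
  by rewrite wtE.
have e2 : s * weight0 z + P z = 0 by have := hz (f (E 0)); rewrite alE.
have z1 : weight1 z = - ((n - 2)%:R / 2 * weight0 z).
  by apply: (mulfI two_neq0); apply/eqP; rewrite -subr_eq0 -[X in _ == X]e1; apply/eqP; field.
have z0 : weight0 z = 0.
  by rewrite -[RHS]e2 Pz z1 /s; field.
have {}z1 : weight1 z = 0 by rewrite z1 z0 mulr0 oppr0.
rewrite z0 z1 !scale0r !addr0 in zE.
(* Now z = f q, and pairing with e_{n-i} leaves coordinate i of [q] up to sign. *)
have qmid i : (0 < i < n)%N -> crd i q = 0.
  move=> hi; have := hz (f (E (n - i)%N)); rewrite alE zE act_f crd_lie_lo // mulr0 add0r.
  rewrite crd_lie_hie; [|lia]; have -> : (n - (n - i) = i)%N by lia.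
  by move=> /eqP; rewrite mulf_eq0 oppr_eq0 signr_eq0 => /eqP.
have qE : q = crd 0 q *: E 0 + crd n q *: E n.
  apply: crd_inj => i hi; rewrite linearD /= !crdZ !crd_e //.
  have [->|i0] := eqVneq i 0%N; first by rewrite /= mulr0 mulr1 addr0.
  have [->|ni] := eqVneq i n; first by rewrite mulr0 mulr1 add0r.
  by rewrite !mulr0 addr0 qmid //; lia.
(* Pairing with [x] and [y] gives the transposed system for the two remaining coordinates of [q]. *)
have hv v : s * (crd 0 q * weight0 v) + (crd 0 q * P v + crd n q * wt (act v) n) = 0.
  have hq : alpha (lie (f q) v) = 0 by rewrite -zE hz.
  have {}hq : alpha (lie v (f q)) = 0 by rewrite lieC linearN /= hq oppr0.
  rewrite -[RHS]hq alE.
  have -> : act v q = crd 0 q *: act v (E 0) + crd n q *: act v (E n).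
    by rewrite {1}qE linearD !linearZ.
  by rewrite actn !linearD /= !crdZ !crd_e // eqxx mulr0 mulr0 addr0 mulr1.
have hx := hv x; have hy := hv y; rewrite !wtE ?x0 ?x1 ?y0 ?y1 in hx hy.
have q0 : crd 0 q = 0.
  (* The equation for [x] minus (n - 2)/2 times that for [y]: the e_n coordinate cancels, and the
     coefficient of the e_0 coordinate is 1 by the choice of [s]. *)
  have -> : crd 0 q = (s * (crd 0 q * 1) + (crd 0 q * P x + crd n q * ((n - 2)%:R * 1 + 2 * 0)))
    - (n - 2)%:R / 2 * (s * (crd 0 q * 0) + (crd 0 q * P y + crd n q * ((n - 2)%:R * 0 + 2 * 1))).
    by rewrite /s; field.
  by rewrite hx hy mulr0 subrr.
have qn : crd n q = 0.
  apply: (mulIf two_neq0); rewrite mul0r -hy q0; ring.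
by rewrite zE qE q0 qn !scale0r addr0 linear0.
Qed.

End NilradicalQ.

Theorem proposition4 (R : realType) (K : fieldType)
    (hK : K = R :> fieldType \/ K = R[i] :> fieldType)
    (k : nat) (hk : (1 <= k)%N) :
  (forall (g : lieAlgType K) (N : {vspace g}),
     lie_complete g -> lie_solvable g -> is_nilradical N ->
     sub_lie_isom (Q_alg K k) N -> symplectic g) /\
  (symplectic_form (@omega K k) /\ exact_form (@omega K k)).
Proof.
have two_neq0 : 2 != 0 :> K.
  by case: hK => ->; rewrite Num.Theory.pnatr_eq0.
split; last first.
  split; last exact: model_exact.
  exact: (exact_symplectic (@omegaE K k) (model_form_nondegenerate two_neq0)).
move=> g N complete solvable nilradical [f [f_inj f_img f_lie]].
exact: (frobenius hk two_neq0 complete solvable nilradical f_inj f_img f_lie).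
Qed.
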